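(* Let $\varepsilon > 0$ be arbitrary. For $N \ge 1$ let $\Theta_N = \{ \theta_5^r\, \theta_{13}^s : r, s \in \mathbb{Z},\ 0 \le r, s \le N \}$. For each integer $n \ge 1$ let $\zeta_1^{(n)}, \zeta_2^{(n)}, \zeta_3^{(n)}$ be any triple of unit complex numbers satisfying $$ n\left(\zeta_1^{(n)} + \zeta_2^{(n)}\right) = \zeta_3^{(n)}, $$ and let $$\Theta'(n,N) = \zeta_1^{(n)} \Theta_N \cup \zeta_2^{(n)} \Theta_N \cup \zeta_3^{(n)} \Theta_N .$$ Then there exist $n, N$ (depending on $\varepsilon$) such that $\bigcup_{\theta \in \Theta'(n,N)} E_\theta = \mathbb{C}$.
   Context: The elements $\theta_5, \theta_{13}$ are the unit complex numbers $\theta_5 = \frac{1+2i}{1-2i}$ and $\theta_{13} = \frac{2+3i}{2-3i}$. The pyjama stripe is $E = E(\varepsilon) = \{ z \in \mathbb{C} : \mathrm{Re}(z) \ (\mathrm{mod}\ 1) \in (-\varepsilon, \varepsilon) \}$, i.e. the set of $z \in \mathbb{C}$ such that $|\mathrm{Re}(z) - k| < \varepsilon$ for some $k \in \mathbb{Z}$. For a unit complex number $\theta$, $E_\theta = \theta^{-1} E = \{ z \in \mathbb{C} : \theta z \in E\}$. For a unit complex number $\zeta$, $\zeta\,\Theta_N = \{\zeta \theta : \theta \in \Theta_N\}$. *)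

(* Defs.v *)
From mathcomp Require Export all_boot all_order all_algebra.
From mathcomp Require Export complex.
From mathcomp Require Export classical_sets reals.

Set Implicit Arguments.
Unset Strict Implicit.
Unset Printing Implicit Defensive.
Import Order.TTheory GRing.Theory Num.Theory.

Local Open Scope ring_scope.
Local Open Scope complex_scope.
Local Open Scope classical_set_scope.

Section Pyjama.
Variable R : realType.
Implicit Types (eps : R) (theta z : R[i]) (N : nat).

Definition theta5 : R[i] := (1 +i* 2 : R[i]) / (1 -i* 2 : R[i]).
Definition theta13 : R[i] := (2 +i* 3 : R[i]) / (2 -i* 3 : R[i]).

Definition stripe eps : set R[i] :=
  [set z : R[i] | exists k : int, `|complex.Re z - k%:~R| < eps].

Definition rot_stripe eps theta : set R[i] :=
  [set z : R[i] | stripe eps (theta * z)].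

Definition Theta N : set R[i] :=
  [set theta5 ^+ r * theta13 ^+ s
     | r in [set r : nat | (r <= N)%N] & s in [set s : nat | (s <= N)%N]].

Definition rotate (zeta : R[i]) (A : set R[i]) : set R[i] :=
  [set zeta * theta | theta in A].

Definition Theta' (zeta1 zeta2 zeta3 : nat -> R[i]) (n N : nat) : set R[i] :=
  rotate (zeta1 n) (Theta N) `|` rotate (zeta2 n) (Theta N)
    `|` rotate (zeta3 n) (Theta N).

End Pyjama.

Arguments theta5 {R}.
Arguments theta13 {R}.
Arguments Theta {R} N.

(* Main.v *)
Require Import Defs.
From HB Require Import structures.
From mathcomp Require Import filter boolp ring lra zify.

(* Write theta5 = P/P' and theta13 = S/S' with P' = 1-2i and S' = 2-3i. The plane
   maps to the solenoid X dual to Z[i][1/P', 1/S'], locally C x Q_5 x Q_13, on which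
   theta5 (resp. theta13) rotates C, expands Q_5 (resp. Q_13) and is an isometry of
   the other factor. Let K be the closed invariant set of points of X whose whole
   orbit has real part at distance at least eps from the integers.

   If two nearby points have a nonzero 5-adic difference, a power of theta5 expands
   that difference to size about 1, and powers of theta13 then multiply it by units
   close to 1; the result runs through a dense subset of C/Z[i] (lemma core). Hence
   K cannot accumulate at a torsion translate of the leaf C of X otherwise than
   along that leaf. By Furstenberg's argument, a nonempty closed invariant subset of K
   avoiding these translates would contain z + r t for all r < q, with t torsion and
   Re t = 1/q; for q > 1/eps this contradicts the definition of K. So K lies in the
   torsion translates of C and, by compactness, q K lies in C for some q.

   Take n = q. Were the stripes never to cover, limits x1, x2, x3 of zeta_i z_N would
   lie in K, and x3 = q (x1 + x2) would belong to C; but rotating a point of C by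
   powers of theta5 brings its real part arbitrarily close to 0. *)

Set Implicit Arguments.
Unset Strict Implicit.
Unset Printing Implicit Defensive.
Import Order.TTheory GRing.Theory Num.Theory.
Local Open Scope ring_scope.
Local Open Scope complex_scope.
Local Open Scope classical_set_scope.

Local Notation Re := complex.Re.
Local Notation Im := complex.Im.
Local Notation nm := Normc.normc.
Local Notation "z ^c" := (conjc z).

(** * Gaussian integers in R[i] *)

Section Norm.
Variable R : realType.
Implicit Types x y z : R[i].

Lemma ReD x y : Re (x + y) = Re x + Re y. Proof. by case: x y => a b []. Qed.
Lemma ImD x y : Im (x + y) = Im x + Im y. Proof. by case: x y => a b []. Qed.
Lemma ReN x : Re (- x) = - Re x. Proof. by case: x. Qed.
Lemma ImN x : Im (- x) = - Im x. Proof. by case: x. Qed.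
Lemma ReM x y : Re (x * y) = Re x * Re y - Im x * Im y.
Proof. by case: x y => a b []. Qed.
Lemma ImM x y : Im (x * y) = Re x * Im y + Im x * Re y.
Proof. by case: x y => a b []. Qed.
Lemma Re_nat n : Re (n%:R : R[i]) = n%:R.
Proof. by rewrite -(rmorph_nat (real_complex R)). Qed.
Lemma Im_nat n : Im (n%:R : R[i]) = 0.
Proof. by rewrite -(rmorph_nat (real_complex R)). Qed.
Lemma Re_int (n : int) : Re (n%:~R : R[i]) = n%:~R.
Proof. by rewrite -(rmorph_int (real_complex R)). Qed.
Lemma Im_int (n : int) : Im (n%:~R : R[i]) = 0.
Proof. by rewrite -(rmorph_int (real_complex R)). Qed.

Lemma normC_nm z : `|z| = (nm z)%:C. Proof. by []. Qed.

Lemma nm_ge0 z : 0 <= nm z.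
Proof. by rewrite -ler0c -normC_nm normr_ge0. Qed.
Lemma nmM x y : nm (x * y) = nm x * nm y. Proof. exact: Normc.normcM. Qed.
Lemma nmD x y : nm (x + y) <= nm x + nm y. Proof. exact: le_normcD. Qed.
Lemma nmN x : nm (- x) = nm x. Proof. exact: normcN. Qed.
Lemma nm0 : nm (0 : R[i]) = 0. Proof. exact: Normc.normc0. Qed.
Lemma nm1 : nm (1 : R[i]) = 1. Proof. exact: Normc.normc1. Qed.
Lemma nmX x n : nm (x ^+ n) = nm x ^+ n.
Proof. by elim: n => [|n IH]; rewrite ?nm1 // !exprS nmM IH. Qed.
Lemma nm_nat n : nm (n%:R : R[i]) = n%:R.
Proof. by apply: complexI; rewrite -normC_nm normr_nat rmorph_nat. Qed.
Lemma nmV x : nm x^-1 = (nm x)^-1. Proof. exact: Normc.normcV. Qed.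
Lemma nm_eq0 x : (nm x == 0) = (x == 0).
Proof. by apply/eqP/eqP => [/Normc.eq0_normc|->]; rewrite ?nm0. Qed.
Lemma nm_gt0 x : (0 < nm x) = (x != 0).
Proof. by rewrite lt_def nm_eq0 nm_ge0 andbT. Qed.
Lemma sqr_nm z : nm z ^+ 2 = Re z ^+ 2 + Im z ^+ 2.
Proof. by case: z => a b /=; rewrite sqr_sqrtr // addr_ge0 ?sqr_ge0. Qed.
Lemma nm_ge_Re z : `|Re z| <= nm z.
Proof. by rewrite -lecR normc_ge_Re. Qed.
Lemma nm_ge_Im z : `|Im z| <= nm z.
Proof.
rewrite -(ler_pXn2r (n := 2)) ?nnegrE ?nm_ge0 //.
by rewrite sqr_nm real_normK ?num_real // lerDr sqr_ge0.
Qed.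
Lemma nm_le_ReIm z : nm z <= `|Re z| + `|Im z|.
Proof.
rewrite -(ler_pXn2r (n := 2)) ?nnegrE ?nm_ge0 ?addr_ge0 //.
rewrite sqr_nm sqrrD !real_normK ?num_real //.
by rewrite -addrA lerD2l lerDr mulrn_wge0 // mulr_ge0.
Qed.
Lemma Re_conjc z : Re z^c = Re z. Proof. by case: z. Qed.
Lemma Im_conjc z : Im z^c = - Im z. Proof. by case: z. Qed.
Lemma nm_conjc z : nm z^c = nm z.
Proof.
have : nm z^c ^+ 2 = nm z ^+ 2 by rewrite !sqr_nm Re_conjc Im_conjc sqrrN.
by move/eqP; rewrite eqrXn2 ?nm_ge0 // => /eqP.
Qed.
Lemma mul_conj z : z * z^c = (nm z ^+ 2)%:C.
Proof. by rewrite sqr_nm; case: z => a b; simpc; congr (_ +i* _); ring. Qed.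

Lemma exprn_unbounded (x a : R) : 1 < a -> exists n, x < a ^+ n.
Proof.
move=> a1; have d0 : 0 < a - 1 by rewrite subr_gt0.
exists (Num.truncn (x / (a - 1))).+1; set n := (X in _ ^+ X).
have h1 : 1 + n%:R * (a - 1) <= a ^+ n.
  elim: n => [|n IH]; first by rewrite mul0r addr0.
  rewrite exprS; apply: le_trans (ler_wpM2l (ltW (lt_trans _ a1)) IH) => //.
  rewrite -[in leRHS](subrK 1 a) addrK -natr1; set b := _ - 1 in d0 *.
  have : 0 <= n%:R * b * b by rewrite !mulr_ge0 // ltW.
  by move=> ?; lra.
apply: lt_le_trans h1.
have := truncnS_gt (x / (a - 1)).
rewrite -/n ltr_pdivrMr // => h2; lra.
Qed.
End Norm.

Section Gaussian.
Variable R : realType.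
Implicit Types x y z : R[i].

Definition gint : {pred R[i]} :=
  [pred z | (Re z \is a Num.int) && (Im z \is a Num.int)].

Lemma gintE z : (z \in gint) = (Re z \is a Num.int) && (Im z \is a Num.int).
Proof. by []. Qed.

Fact gint_subring : subring_closed gint.
Proof.
split=> [|x y|x y]; rewrite ?gintE /=.
- by rewrite rpred1 rpred0.
- move=> /andP[? ?] /andP[? ?].
  by rewrite !(ReD, ImD, ReN, ImN) !rpredB.
- move=> /andP[? ?] /andP[? ?].
  by rewrite ReM ImM rpredB ?rpredD ?rpredM.
Qed.
HB.instance Definition _ := GRing.isSubringClosed.Build R[i] gint gint_subring.

Lemma gintD x y : x \in gint -> y \in gint -> x + y \in gint.
Proof. exact: rpredD. Qed.
Lemma gintN x : x \in gint -> - x \in gint. Proof. by rewrite rpredN. Qed.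
Lemma gintM x y : x \in gint -> y \in gint -> x * y \in gint.
Proof. exact: rpredM. Qed.
Lemma gintX x n : x \in gint -> x ^+ n \in gint. Proof. exact: rpredX. Qed.
Lemma gint0 : 0 \in gint. Proof. exact: rpred0. Qed.
Lemma gint1 : 1 \in gint. Proof. exact: rpred1. Qed.
Lemma gint_nat n : n%:R \in gint. Proof. exact: rpred_nat. Qed.
Lemma gint_int (n : int) : n%:~R \in gint. Proof. exact: rpred_int. Qed.

Lemma gint_conj z : z \in gint -> z^c \in gint.
Proof. by rewrite !gintE Re_conjc Im_conjc rpredN. Qed.

Lemma gint_congr x y : x - y \in gint -> (x \in gint) = (y \in gint).
Proof.
move=> h; apply/idP/idP => g; last by rewrite -(subrK y x) rpredD.
have -> : y = x - (x - y) by ring.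
exact: rpredB.
Qed.

Lemma gint_mk (m n : int) : (m%:~R +i* n%:~R : R[i]) \in gint.
Proof. by rewrite gintE /= !intr_int. Qed.

Lemma gint_nm_lt1 z : z \in gint -> nm z < 1 -> z = 0.
Proof.
rewrite gintE => /andP[hr hi] h.
have small (a : R) : a \is a Num.int -> `|a| <= nm z -> a = 0.
  move=> ha hle; apply/eqP; apply: contraT => /(norm_intr_ge1 ha) h1.
  by have := le_lt_trans (le_trans h1 hle) h; rewrite ltxx.
have a0 := small _ hr (nm_ge_Re z); have b0 := small _ hi (nm_ge_Im z).
by apply/eqP; rewrite eq_complex a0 b0 !eqxx.
Qed.

Lemma gint_nm_ge1 z : z \in gint -> z != 0 -> 1 <= nm z.
Proof. by move=> hz; apply: contraNT; rewrite -ltNge => /(gint_nm_lt1 hz) ->. Qed.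

Definition gfloor z : R[i] :=
  (Num.floor (Re z))%:~R +i* (Num.floor (Im z))%:~R.

Lemma gfloor_gint z : gfloor z \in gint. Proof. exact: gint_mk. Qed.

Lemma gfloorP z : [/\ 0 <= Re (z - gfloor z), Re (z - gfloor z) < 1,
   0 <= Im (z - gfloor z) & Im (z - gfloor z) < 1].
Proof.
rewrite !(ReD, ImD, ReN, ImN) /=.
have /andP[h1 h2] := floor_itv (Re z); have /andP[h3 h4] := floor_itv (Im z).
move: h2 h4; rewrite !intrD => h2 h4.
by rewrite !subr_ge0 h1 h3; split=> //; rewrite ltrBlDl.
Qed.

Lemma gint_round z : exists2 g, g \in gint & nm (z - g) <= 1.
Proof.
pose g := gfloor (z + (2^-1 +i* 2^-1)); exists g; first exact: gfloor_gint.
have [] := gfloorP (z + (2^-1 +i* 2^-1)); rewrite -/g.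
rewrite !(ReD, ImD, ReN, ImN) /= => h1 h2 h3 h4.
apply: le_trans (nm_le_ReIm _) _; rewrite !(ReD, ImD, ReN, ImN).
have -> : 1 = 2^-1 + 2^-1 :> R by field.
by apply: lerD; rewrite ler_norml; apply/andP; split; lra.
Qed.

(** Distinct Gaussian integers are at distance at least 1, so two approximations of [z] closer than
    1/2 coincide. *)
Lemma gint_closed z :
  (forall e : R, 0 < e -> exists2 g, g \in gint & nm (z - g) < e) -> z \in gint.
Proof.
move=> H; have [g gg hg] := H (2^-1) ltac:(by rewrite invr_gt0 ltr0n).
suff -> : z = g by [].
apply/eqP; rewrite -subr_eq0 -nm_eq0 eq_le nm_ge0 andbT.
apply/ler_addgt0Pr => e e0; rewrite add0r.
have [g' gg' hg'] := H (Num.min e 2^-1) ltac:(by rewrite lt_min e0 invr_gt0 ltr0n).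
move: hg'; rewrite lt_min => /andP[h1 h2].
have e1 : g' - g = 0.
  apply: gint_nm_lt1; first exact: rpredB.
  have -> : g' - g = (z - g) - (z - g') by ring.
  apply: le_lt_trans (nmD _ _) _; rewrite nmN.
  have -> : 1 = 2^-1 + 2^-1 :> R by field.
  exact: ltrD.
by rewrite -(subr0 (z - g)) -e1 opprB addrA subrK ltW.
Qed.

(** Coprimality as a Bezout identity, the form in which [copr_cancel] clears denominators. *)
Definition copr x y := exists2 u, u \in gint & exists2 v, v \in gint & u * x + v * y = 1.

Lemma copr_sym x y : copr x y -> copr y x.
Proof. by case=> u gu [v gv h]; exists v => //; exists u => //; rewrite addrC. Qed.

Lemma coprM x y z : x \in gint -> y \in gint -> z \in gint ->
  copr x z -> copr y z -> copr (x * y) z.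
Proof.
move=> gx gy gz [u gu [v gv h]] [u' gu' [v' gv' h']].
exists (u * u'); first exact: rpredM.
exists (u * x * v' + v * u' * y + v * v' * z).
  by rewrite !rpredD // !rpredM.
by rewrite -[RHS]mulr1 -{1}h -h'; ring.
Qed.

Lemma copr1 x : copr 1 x.
Proof. by exists 1; rewrite ?rpred1 //; exists 0; rewrite ?rpred0 // mulr1 mul0r addr0. Qed.

Lemma coprXl x y n : x \in gint -> y \in gint -> copr x y -> copr (x ^+ n) y.
Proof.
move=> gx gy h; elim: n => [|n IH]; first exact: copr1.
by rewrite exprS; apply: coprM => //; rewrite rpredX.
Qed.

Lemma coprX x y m n : x \in gint -> y \in gint -> copr x y -> copr (x ^+ m) (y ^+ n).
Proof.
move=> gx gy h; apply: coprXl => //; first by rewrite rpredX.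
by apply: copr_sym; apply: coprXl => //; apply: copr_sym.
Qed.

Lemma copr_cancel x y z : copr x y -> x * z \in gint -> y * z \in gint -> z \in gint.
Proof.
move=> [u gu [v gv h]] hx hy.
by rewrite -[z]mul1r -h mulrDl -!mulrA rpredD // rpredM.
Qed.

Lemma copr_dvd x y z w : copr x y -> z \in gint -> w \in gint -> y * z = x * w ->
  exists2 g, g \in gint & z = x * g.
Proof.
move=> [u gu [v gv h]] gz gw e; exists (u * z + v * w); first by rewrite rpredD ?rpredM.
by rewrite -[LHS]mul1r -h !mulrDl -mulrA -(mulrA v) e; ring.
Qed.

End Gaussian.

Ltac gint_tac := by repeat first [ assumption | apply: gintD | apply: gintN
  | apply: gintM | apply: gintX | apply: gint1 | apply: gint0
  | apply: gint_nat | apply: gint_int ].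

(** * Limits along an ultrafilter *)

Section UltraLimit.
Variable R : realType.
Implicit Types (U : set_system nat) (e : R).

(** A nonprincipal ultrafilter gives limits of all coordinates of a sequence at once, in place of a
    diagonal extraction of subsequences. *)
Lemma ultra_nat : exists U : set_system nat,
  UltraFilter U /\ forall N, U [set n | (N <= n)%N].
Proof.
have [U [UU sub]] := ultraFilterLemma eventually_filter.
by exists U; split=> // N; apply: sub; exists N.
Qed.

Lemma ultra_cvg_itv U (UU : UltraFilter U) (x : nat -> R) :
  (forall j, 0 <= x j <= 1) ->
  exists l, forall e, 0 < e -> U [set j | `|x j - l| < e].
Proof.
(* The limit is the supremum of the numbers that bound [x j] from below for [U]-almost all [j]. *)
move=> x01; pose E : set R := [set r | U [set j | r <= x j]].
have sE : has_sup E.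
  split; first by exists 0; apply: filterS filterT => j _ /=; case/andP: (x01 j).
  exists 1 => r /= /filter_ex [j /= h].
  by apply: le_trans h _; case/andP: (x01 j).
exists (sup E) => e e0.
have [r Er rl] := sup_adherent e0 sE.
have : ~ E (sup E + e).
  by move=> /(sup_upper_bound sE); rewrite leNgt ltrDl e0.
have [//|Un _] := in_ultra_setVsetC [set j | sup E + e <= x j] UU.
apply: filterS (filterI Er Un) => j [/= h1 /negP]; rewrite -ltNge => h2.
by rewrite ltr_norml; apply/andP; split; lra.
Qed.

(** C/Z[i] is compact: subtracting [gfloor] brings the points into the unit square. *)
Lemma ultra_cvg_mod U (UU : UltraFilter U) (x : nat -> R[i]) :
  exists l : R[i], forall e, 0 < e ->
    U [set j | exists2 g, g \in @gint R & nm (x j - l - g) < e].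
Proof.
pose y j := x j - gfloor (x j).
have yb j : (0 <= Re (y j) <= 1) /\ (0 <= Im (y j) <= 1).
  have [a b c d] := gfloorP (x j).
  by rewrite /y a c !ltW.
have [a Ha] := ultra_cvg_itv UU (fun j => (yb j).1).
have [b Hb] := ultra_cvg_itv UU (fun j => (yb j).2).
exists (a +i* b) => e e0.
have e2 : 0 < e / 2 by rewrite divr_gt0.
apply: filterS (filterI (Ha _ e2) (Hb _ e2)) => j [/= h1 h2].
exists (gfloor (x j)); first exact: gfloor_gint.
rewrite addrAC -/(y j); move: (y j) h1 h2 => w h1 h2.
apply: le_lt_trans (nm_le_ReIm _) _; rewrite !(ReD, ImD, ReN, ImN) /=.
by rewrite [e]splitr; apply: ltrD.
Qed.

Lemma gint_recurrence (x : nat -> R[i]) e : 0 < e ->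
  exists i j, (i < j)%N /\ exists2 g, g \in @gint R & nm (x j - x i - g) < e.
Proof.
move=> e0; have [U [UU UN]] := ultra_nat.
have [l Hl] := ultra_cvg_mod UU x.
have e2 : 0 < e / 2 by rewrite divr_gt0.
have [i [g gg hi]] := filter_ex (Hl _ e2).
have [j [/= ij [g' gg' hj]]] := filter_ex (filterI (UN i.+1) (Hl _ e2)).
exists i, j; split=> //; exists (g' - g); first exact: rpredB.
have -> : x j - x i - (g' - g) = (x j - l - g') - (x i - l - g) by ring.
by apply: le_lt_trans (nmD _ _) _; rewrite nmN [e]splitr; apply: ltrD.
Qed.

(* Applied to tau^l / q: the powers of tau are eventually periodic mod q. *)
Lemma gint_powers_periodic (q : nat) (tau : R[i]) : (0 < q)%N -> tau \in @gint R ->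
  exists l0 M, (0 < M)%N /\ exists2 g, g \in @gint R &
    tau ^+ (l0 + M) - tau ^+ l0 = q%:R * g.
Proof.
move=> q0 gt.
have q0' : 0 < q%:R :> R by rewrite ltr0n.
have qV : 0 < (q%:R)^-1 :> R by rewrite invr_gt0.
have [i [j [ij [g gg h]]]] := gint_recurrence (fun l => tau ^+ l / q%:R) qV.
exists i, (j - i)%N; rewrite subn_gt0; split=> //; exists g => //.
rewrite subnKC ?(ltnW ij) //.
apply/eqP; rewrite -subr_eq0; apply/eqP/gint_nm_lt1.
  by rewrite !rpredB ?rpredX // rpredM // rpred_nat.
have q0C : (q%:R : R[i]) != 0 by rewrite pnatr_eq0 -lt0n.
have -> : tau ^+ j - tau ^+ i - q%:R * g = q%:R * (tau ^+ j / q%:R - tau ^+ i / q%:R - g).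
  by rewrite !mulrBr !(mulrCA q%:R) divff // !mulr1.
by rewrite nmM nm_nat mulrC -ltr_pdivlMr // mul1r.
Qed.

Lemma unit_powers_recur (u : R[i]) e : nm u = 1 -> 0 < e ->
  exists M, (0 < M)%N /\ nm (u ^+ M - 1) < e.
Proof.
move=> u1 e0; pose d := Num.min (e / 4) 4^-1.
have d0 : 0 < d by rewrite lt_min !divr_gt0 // invr_gt0 ltr0n.
(* After division by 4 the differences have norm at most 1/2, which forces the Gaussian integer [g]
   to be 0; the approximation then holds in C and not only modulo Z[i]. *)
have [i [j [ij [g gg h]]]] := gint_recurrence (fun l => u ^+ l / 4) d0.
have nu l : nm (u ^+ l) = 1 by rewrite nmX u1 expr1n.
have n4 : nm (4 : R[i]) = 4 by rewrite nm_nat.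
have b : nm (u ^+ j / 4 - u ^+ i / 4) <= 2^-1.
  apply: le_trans (nmD _ _) _; rewrite nmN !nmM !nu nmV n4; lra.
move: h; rewrite lt_min => /andP[h1 h2].
have g0 : g = 0.
  apply: gint_nm_lt1 => //.
  have -> : g = (u ^+ j / 4 - u ^+ i / 4) - (u ^+ j / 4 - u ^+ i / 4 - g) by ring.
  apply: le_lt_trans (nmD _ _) _; rewrite nmN; lra.
move: h1; rewrite g0 subr0 => h1.
exists (j - i)%N; rewrite subn_gt0; split=> //.
have -> : nm (u ^+ (j - i) - 1) = nm (4 * (u ^+ j / 4 - u ^+ i / 4)).
  rewrite -[LHS]mul1r -(nu i) -nmM; congr nm.
  rewrite mulrBr -exprD subnKC ?(ltnW ij) // mulr1.
  by rewrite mulrBr !(mulrC 4) !divfK // pnatr_eq0.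
by rewrite nmM n4 mulrC -ltr_pdivlMr.
Qed.

End UltraLimit.

(** * Gaussian primes *)

Section GaussianPrime.
Variable R : realType.
Implicit Types (P x y z : R[i]) (p h : nat).
Local Notation gint := (@gint R).

(** A split prime: [P] and its conjugate P' lie over [p] and are coprime, so that Z[i]/P'^h is
    isomorphic to Z/p^h. *)
Definition gprime P p :=
  [/\ P \in gint, prime p, P * P^c = p%:R & copr P P^c].

Lemma gint_Re_trace x : x \in gint -> exists n : int, x + x^c = n%:~R.
Proof.
rewrite gintE => /andP[/intrP[m hm] _]; exists (m * 2).
apply/eqP; rewrite eq_complex ReD ImD Re_conjc Im_conjc Re_int Im_int subrr eqxx andbT.
by rewrite hm intrM mulr_natr mulr2n.
Qed.

Variables (P : R[i]) (p : nat).
Hypothesis hP : gprime P p.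

Lemma gprime_gint : P \in gint. Proof. by case: hP. Qed.
Lemma gprime_conj_gint : P^c \in gint. Proof. exact: gint_conj gprime_gint. Qed.
Let gP := gprime_gint.
Let gP' := gprime_conj_gint.

Lemma gprime_nm_sqr : nm P^c ^+ 2 = p%:R.
Proof.
have [_ _ e _] := hP.
have : (nm (P^c) ^+ 2)%:C = (p%:R : R)%:C.
  by rewrite -mul_conj conjcK mulrC e rmorph_nat.
by move/complexI.
Qed.

Lemma gprime_nm_gt1 : 1 < nm P^c.
Proof.
rewrite -(ltr_pXn2r (n := 2)) ?nnegrE ?nm_ge0 // gprime_nm_sqr expr1n ltr1n.
by case: hP => _ /prime_gt1.
Qed.

Lemma gprime_conj_neq0 : P^c != 0.
Proof. by rewrite -nm_gt0 (lt_trans _ gprime_nm_gt1). Qed.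

Lemma gprime_neq0 : P != 0.
Proof. by rewrite -nm_gt0 -nm_conjc (lt_trans _ gprime_nm_gt1). Qed.

(* With u P^h + v P'^h = 1, the trace of g u P^h is congruent to g mod P'^h. *)
Lemma gprime_residue h g : g \in gint ->
  exists n : int, exists2 w, w \in gint & g = n%:~R + P^c ^+ h * w.
Proof.
move=> gg; have [_ _ _ c] := hP.
have [u gu [v gv e]] := coprX h h gP gP' c.
pose x := g * u * P ^+ h.
have gx : x \in gint by rewrite !rpredM // rpredX.
have [n hn] := gint_Re_trace gx.
exists n, (g * v - g^c * u^c); first by rewrite rpredB ?rpredM ?gint_conj.
rewrite -hn /x !rmorphM rmorphXn /= -[LHS]mulr1 -e; ring.
Qed.

(** Modulo P', [b] is an integer, which is either a multiple of p = P P' or invertible modulo p. *)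
Lemma gprime_dvd_or_copr b : b \in gint ->
  (exists2 w, w \in gint & b = P^c * w) \/ copr b P^c.
Proof.
move=> gb; have [n [w gw e]] := gprime_residue 1 gb; have [_ pp eP _] := hP.
rewrite expr1 in e.
have [/dvdzP[k hk]|np] := boolP (p %| n)%Z.
  left; exists (k%:~R * P + w); first by rewrite rpredD // rpredM // rpred_int.
  by rewrite e hk intrM -pmulrn -eP; ring.
right.
have /coprimezP[[u v] /= huv] : coprimez n p.
  by rewrite coprimezE coprime_sym prime_coprime.
exists u%:~R; first exact: rpred_int.
exists (v%:~R * P - u%:~R * w); first by rewrite rpredB // rpredM // rpred_int.
have E : (1 : R[i]) = u%:~R * n%:~R + v%:~R * p%:R.
  by rewrite [in RHS]pmulrn -!intrM -intrD huv.
by rewrite [RHS]E -eP e; ring.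
Qed.

Lemma gprime_factor x : x \in gint -> x != 0 ->
  exists E b, [/\ b \in gint, x = P^c ^+ E * b & copr b P^c].
Proof.
(* Induction on an exponent [n] with |x| < |P'|^n, which each division by P' lowers by one. *)
have [n] := exprn_unbounded (nm x) gprime_nm_gt1.
elim: n x => [|n IH] x hx gx x0.
  by move: (gint_nm_ge1 gx x0); rewrite leNgt hx.
have [[w gw e]|c] := gprime_dvd_or_copr gx; last first.
  by exists 0%N, x; rewrite expr0 mul1r.
have w0 : w != 0 by apply: contraNneq x0 => w0; rewrite e w0 mulr0.
have [|||E [b [gb hb c]]] // := IH w.
  by move: hx; rewrite e nmM exprS ltr_pM2l // (lt_trans _ gprime_nm_gt1).
by exists E.+1, b; rewrite e hb exprS mulrA.
Qed.

End GaussianPrime.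

Lemma gint_annihilator (R : realType) (x : R[i]) : x \in @gint R -> x != 0 ->
  exists (q : nat) y, [/\ (0 < q)%N, y \in @gint R & y * x = q%:R].
Proof.
move=> gx x0.
have : nm x ^+ 2 \is a Num.int.
  by move: (gx); rewrite gintE sqr_nm => /andP[? ?]; rewrite rpredD ?rpredX.
move=> /intrP[k hk].
have k0 : 0 < k by rewrite -(ltr_int R) -hk exprn_gt0 // nm_gt0.
exists `|k|%N, x^c; rewrite absz_gt0 gt_eqF // gint_conj //; split=> //.
by rewrite mulrC mul_conj hk -[k in LHS]gtz0_abs // rmorph_nat.
Qed.

(** * The solenoid dual to Z[i][1/P', 1/S'] *)

Section Solenoid.
Variable R : realType.
Implicit Types (P S z : R[i]) (p s h k l m n : nat).
Implicit Types (x y d t : nat -> nat -> R[i]).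
Local Notation gint := (@gint R).

(* x k l stands for the value at 1 / (P'^k S'^l) of a character of the group
   Z[i][1/P', 1/S'], where P' and S' are the conjugates of P and S. *)
Definition coherent P S x :=
  (forall k l, P^c * x k.+1 l - x k l \in gint) /\
  (forall k l, S^c * x k l.+1 - x k l \in gint).

Definition prime_pair P p S s :=
  [/\ gprime P p, gprime S s, copr P^c S^c, copr S P^c & copr P S^c].

(** If a^M = b^M, a Bezout identity makes b^M a unit of Z[i], of norm 1, against |b| <> 1. Applied
    to a prime and its conjugate, this says that P/P' is not a root of unity. *)
Lemma copr_pow_neq (a b : R[i]) : copr a b -> nm b != 1 -> a \in gint -> b \in gint ->
  nm a = nm b -> forall M, (0 < M)%N -> a ^+ M != b ^+ M.
Proof.
move=> c nb ga gb nab M M0; apply/eqP => e.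
have [u gu [v gv h]] := coprX M M ga gb c.
have : b ^+ M * (u + v) = 1 by rewrite mulrDr mulrC (mulrC _ v) -{1}e.
move=> h1.
have nz : b ^+ M != 0.
  by apply/eqP => z; move: h1; rewrite z mul0r => /esym/eqP; rewrite oner_eq0.
have nz' : u + v != 0.
  by apply/eqP => z; move: h1; rewrite z mulr0 => /esym/eqP; rewrite oner_eq0.
have := congr1 (@Normc.normc R) h1; rewrite nmM nm1 => h2.
have l1 := gint_nm_ge1 (rpredX M gb) nz.
have l2 := gint_nm_ge1 (rpredD gu gv) nz'.
have e1 : nm (b ^+ M) = 1.
  apply/eqP; rewrite eq_le l1 andbT -h2 -[leLHS]mulr1 ler_wpM2l //; exact: nm_ge0.
move: e1; rewrite nmX => /eqP; rewrite pexpr_eq1 ?nm_ge0 //.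
by rewrite (negPf nb).
Qed.

Section Pair.
Variables (P S : R[i]) (p s : nat).
Hypothesis ok : prime_pair P p S s.

Let hP : gprime P p. Proof. by case: ok. Qed.
Let hS : gprime S s. Proof. by case: ok. Qed.
Let gP : P \in gint. Proof. exact: gprime_gint hP. Qed.
Let gS : S \in gint. Proof. exact: gprime_gint hS. Qed.
Let gP' : P^c \in gint. Proof. exact: gprime_conj_gint hP. Qed.
Let gS' : S^c \in gint. Proof. exact: gprime_conj_gint hS. Qed.

Lemma coherent_iter x : coherent P S x -> forall i j k l,
  P^c ^+ i * S^c ^+ j * x (k + i)%N (l + j)%N - x k l \in gint.
Proof.
move=> [h1 h2] i; elim: i => [|i IH] j k l.
  elim: j l => [|j IH] l; first by rewrite !expr0 !mul1r !addn0 subrr rpred0.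
  rewrite !addn0 in IH *.
  have -> : P^c ^+ 0 * S^c ^+ j.+1 * x k (l + j.+1)%N - x k l =
     S^c * (P^c ^+ 0 * S^c ^+ j * x k (l.+1 + j)%N - x k l.+1) + (S^c * x k l.+1 - x k l).
    by rewrite addSnnS exprS; ring.
  by rewrite rpredD // rpredM.
have -> : P^c ^+ i.+1 * S^c ^+ j * x (k + i.+1)%N (l + j)%N - x k l =
   P^c * (P^c ^+ i * S^c ^+ j * x (k.+1 + i)%N (l + j)%N - x k.+1 l) + (P^c * x k.+1 l - x k l).
  by rewrite addSnnS exprS; ring.
by rewrite rpredD // rpredM.
Qed.

Lemma coherent_iterP x k i l : coherent P S x -> P^c ^+ i * x (k + i)%N l - x k l \in gint.
Proof. by move=> /coherent_iter/(_ i 0%N k l); rewrite expr0 mulr1 addn0. Qed.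

Lemma coherent_iterS x k l j : coherent P S x -> S^c ^+ j * x k (l + j)%N - x k l \in gint.
Proof. by move=> /coherent_iter/(_ 0%N j k l); rewrite expr0 mul1r addn0. Qed.

Lemma coherent_gint_down x k l k' l' : coherent P S x -> (k' <= k)%N -> (l' <= l)%N ->
  x k l \in gint -> x k' l' \in gint.
Proof.
move=> hx hk hl gx; have := coherent_iter hx (k - k') (l - l') k' l'.
rewrite !subnKC // => h.
by rewrite -(gint_congr h) !rpredM ?rpredX.
Qed.

(** The coordinate [x k l] becomes integral when multiplied by P'^k, and also when multiplied by
    S'^l; these factors are coprime. *)
Lemma coherent_gint_join x k l : coherent P S x -> x k 0%N \in gint -> x 0%N l \in gint ->
  x k l \in gint.
Proof.
move=> hx h1 h2; have [_ _ c _ _] := ok.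
apply: (copr_cancel (coprX k l gP' gS' c)).
  by have := coherent_iterP 0 k l hx; rewrite add0n => /gint_congr ->.
by have := coherent_iterS k 0 l hx; rewrite add0n => /gint_congr ->.
Qed.

(** A binomial expansion to first order in [c]. In [core], [c] carries a power of P' that makes the
    remainder term integral. *)
Lemma expand_near_power (b c : R[i]) l n : b \in gint -> c \in gint -> (l <= n)%N ->
  exists2 g, g \in gint &
    (b + c) ^+ l * b ^+ (n - l) = b ^+ n + l%:R * (b ^+ n.-1 * c) + c ^+ 2 * g.
Proof.
move=> gb gc; elim: l => [|l IH] ln.
  by exists 0; rewrite ?rpred0 // expr0 mul1r subn0 mul0r mulr0 !addr0.
have [g gg e] := IH (ltnW ln).
have e1 : (n - l = (n - l.+1).+1)%N by rewrite subnSK.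
have e2 : n = n.-1.+1 by rewrite prednK // (leq_ltn_trans _ ln).
have [g' gg' e'] : exists2 g', g' \in gint &
    (b + c) ^+ l * b ^+ (n - l.+1) = b ^+ n.-1 + c * g'.
  exists ((\sum_(i < l) (b + c) ^+ (l.-1 - i) * b ^+ i) * b ^+ (n - l.+1)).
    rewrite rpredM ?rpredX // rpred_sum // => i _.
    by rewrite rpredM // rpredX // rpredD.
  have := subrXX (b + c) b l; rewrite (addrC b) addrK => h.
  rewrite mulrA -h mulrBl -exprD.
  have -> : (l + (n - l.+1) = n.-1)%N by lia.
  by rewrite [RHS]addrC subrK.
exists (g + g'); first exact: rpredD.
have -> : (b + c) ^+ l.+1 * b ^+ (n - l.+1) =
   (b + c) ^+ l * b ^+ (n - l) + c * ((b + c) ^+ l * b ^+ (n - l.+1)).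
  by rewrite e1 !exprS; ring.
by rewrite e e' -natr1; ring.
Qed.

(** The hypotheses say that [a] has exact order P'^h modulo Z[i]. As Z[i]/P'^h = Z/p^h, the
    multiples of [a] fill P'^(-h) Z[i] modulo Z[i], which meets every closed disc of radius
    |P'|^(-h). *)
Lemma torsion_dense h (a c0 tau : R[i]) : a * P^c ^+ h \in gint ->
  copr (a * P^c ^+ h) P^c ->
  exists l, (l < p ^ h)%N /\ exists2 g, g \in gint &
    nm (c0 + l%:R * a - tau - g) <= (nm P^c ^+ h)^-1.
Proof.
move=> ga c; have nz : P^c ^+ h != 0 by rewrite expf_neq0 // (gprime_conj_neq0 hP).
have [g' gg' hg'] := gint_round ((tau - c0) * P^c ^+ h).
set b := a * P^c ^+ h in ga c.
have [u gu [v gv huv]] : copr b (P^c ^+ h).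
  by apply: copr_sym; apply: coprXl => //; exact: copr_sym.
(* Since [u] inverts [b] modulo P'^h, an integer [n] congruent to u g' makes n b congruent to g';
   [l] is its residue modulo p^h. *)
have [n [w gw hn]] := gprime_residue hP h (rpredM gu gg').
have [_ pp eP _] := hP.
have p0 : (0 < p ^ h)%N by rewrite expn_gt0 prime_gt0.
pose l := `|(n %% (p ^ h)%N)%Z|%N.
have hl : (l%:Z = n %% (p ^ h)%N)%Z.
  by rewrite /l gez0_abs // modz_ge0 // eqz_nat -lt0n.
have lt : (l < p ^ h)%N by rewrite -ltz_nat hl ltz_pmod.
exists l; split=> //.
have hn2 : n = (n %/ (p ^ h)%N)%Z * (p ^ h)%N + l by rewrite hl -divz_eq.
set q := (n %/ (p ^ h)%N)%Z in hn2.
have hl2 : (l%:R : R[i]) = n%:~R - q%:~R * (P * P^c) ^+ h.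
  by rewrite eP hn2 intrD intrM -!pmulrn -natrX addrC addKr.
pose g2 := - (w * b) - q%:~R * P ^+ h * b - v * g'.
have E : l%:R * b = g' + P^c ^+ h * g2.
  have -> : (l%:R : R[i]) = u * g' - P^c ^+ h * w - q%:~R * (P * P^c) ^+ h.
    by rewrite hl2 hn addrK.
  rewrite exprMn /g2 -[X in _ = X + _]mulr1 -huv; ring.
exists g2.
  by rewrite /g2; gint_tac.
have -> : c0 + l%:R * a - tau - g2 = - (((tau - c0) * P^c ^+ h - g') / P^c ^+ h).
  have -> : l%:R * a = g' / P^c ^+ h + g2.
    apply: (mulIf nz); rewrite -mulrA -/b E mulrDl divfK // mulrC; ring.
  by rewrite mulrBl mulfK //; ring.
rewrite nmN nmM nmV nmX ler_piMl // invr_ge0 exprn_ge0 //; exact: nm_ge0.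
Qed.

(** The index [k] records the P'-adic size of [x]: it is the last level at which the coordinate is
    trivial. *)
Lemma exists_last_gint x N D : coherent P S x -> x D 0%N \in gint -> x N 0%N \notin gint ->
  exists k, [/\ (D <= k)%N, x k 0%N \in gint & x k.+1 0%N \notin gint].
Proof.
move=> hx hD hN; apply: contrapT => nk.
have all_k i : x (D + i)%N 0%N \in gint.
  elim: i => [|i IH]; first by rewrite addn0.
  rewrite addnS; apply: contrapT => /negP h; apply: nk.
  by exists (D + i)%N; rewrite leq_addr.
move/negP: hN; apply; apply: coherent_gint_down (all_k N) => //; exact: leq_addl.
Qed.

(** Let [v] invert S' modulo P'^H. The powers of S v are eventually periodic, and purely so because
    S v is a unit there; then S^M and S'^M agree. *)
Lemma prime_power_period H : exists M, (0 < M)%N /\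
  exists2 g, g \in gint & S ^+ M - S^c ^+ M = P^c ^+ H * g.
Proof.
have [_ _ c1 c2 _] := ok; have [_ pp eP _] := hP.
have gPH : P^c ^+ H \in gint by rewrite rpredX.
have [u gu [v gv huv]] : copr (P^c ^+ H) S^c by exact: coprXl.
have cv : copr v (P^c ^+ H).
  by exists S^c => //; exists u => //; rewrite addrC mulrC (mulrC _ v) mulrC -huv addrC mulrC.
have gSv : S * v \in gint by rewrite rpredM.
have cSv : copr (S * v) (P^c ^+ H).
  apply: coprM => //; by apply: copr_sym; apply: coprXl => //; apply: copr_sym.
have q0 : (0 < p ^ H)%N by rewrite expn_gt0 prime_gt0.
have [i0 [M [M0 [g gg e]]]] := gint_powers_periodic q0 gSv.
exists M; split=> //.
have [g1 gg1 e1] : exists2 g1, g1 \in gint & (S * v) ^+ M - 1 = P^c ^+ H * g1.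
  apply: (@copr_dvd _ _ ((S * v) ^+ i0) _ (P ^+ H * g)).
  - apply: copr_sym; exact: coprXl.
  - by rewrite rpredB ?rpredX // rpred1.
  - by rewrite rpredM // rpredX.
  - by rewrite mulrBr mulr1 -exprD e natrX -eP exprMn; ring.
have [g2 gg2 e2] : exists2 g2, g2 \in gint & (v * S^c) ^+ M - 1 = P^c ^+ H * g2.
  exists (- u * \sum_(i < M) (v * S^c) ^+ (M.-1 - i) * 1 ^+ i).
    rewrite rpredM ?rpredN // rpred_sum // => i _.
    by rewrite expr1n mulr1 rpredX // rpredM.
  rewrite -[X in _ - X](expr1n _ M) subrXX.
  have -> : v * S^c - 1 = - (u * P^c ^+ H) by rewrite -huv; ring.
  by ring.
exists (g1 * S^c ^+ M - S ^+ M * g2).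
  by rewrite rpredB // rpredM ?rpredX.
have -> : P^c ^+ H * (g1 * S^c ^+ M - S ^+ M * g2) =
   ((S * v) ^+ M - 1) * S^c ^+ M - S ^+ M * ((v * S^c) ^+ M - 1) by rewrite e1 e2; ring.
by rewrite !exprMn; ring.
Qed.

(** Write S^M = S'^M + P'^E beta with [beta] prime to P'. Modulo Z[i] the value in question is P^K
    S^i0 S^(Ml) S'^(M(Q-l)) Y. Its first-order term in P'^E is l kap y, where y = P'^E Y has exact
    order P'^h'; its second-order term is integral because P'^(2E) Y is. Varying [l] then gives
    density by [torsion_dense]. The offset [i0] allows for a preperiod, and [D'] is the level at
    which the result is read. *)
Lemma core m h D' i0 M : (0 < m)%N -> (0 < M)%N ->
  (exists2 g, g \in gint & S ^+ M - S^c ^+ M = P^c ^+ (h + m) * g) ->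
  forall d, coherent P S d -> d 0%N (i0 + M * p ^ (h + m) + D')%N \in gint -> d D' 0%N \in gint ->
  (exists N, d N 0%N \notin gint) ->
  exists K, (m %| K)%N /\ forall tau, exists l, (l <= p ^ (h + m))%N /\
    exists2 g, g \in gint &
    nm (P ^+ K * S ^+ (i0 + M * l) * d (K + D')%N (i0 + M * l + D')%N - tau - g)
      <= (nm P^c ^+ h)^-1.
Proof.
move=> m0 M0 [gam ggam hgam] d sd d0 dD [N dN].
have [_ _ c1 c2 c3] := ok; have [_ pp eP cP] := hP.
set Q := (p ^ (h + m))%N in d0 *.
have SM : S ^+ M - S^c ^+ M != 0.
  rewrite subr_eq0; apply: copr_pow_neq => //; first by case: hS.
    by rewrite gt_eqF // (gprime_nm_gt1 hS).
  by rewrite nm_conjc.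
have gam0 : gam != 0 by apply: contraNneq SM => g0; rewrite hgam g0 mulr0.
have [E0 [beta [gbeta hbeta cbeta]]] := gprime_factor hP ggam gam0.
pose E := (h + m + E0)%N.
have SME : S ^+ M = S^c ^+ M + P^c ^+ E * beta.
  by rewrite -[LHS](subrK (S^c ^+ M)) hgam hbeta /E (exprD _ (h + m) E0); ring.
have [k [Dk dk dk1]] := exists_last_gint sd dD dN.
(* Letting h' range over the [m] values from h + 1 to h + m leaves room for a [K] divisible by
   [m]. *)
have [K [h' [mK hK hh' hm']]] : exists K h',
    [/\ (m %| K)%N, (K + D' = k + E + h')%N, (h < h')%N & (h' <= h + m)%N].
  clearbody E; clear -m0 Dk; pose n0 := (k + E + h - D')%N.
  have K1 : (n0 < m * (n0 %/ m).+1)%N by rewrite mulnC; exact: ltn_ceil.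
  have K2 : (m * (n0 %/ m).+1 <= n0 + m)%N.
    by rewrite mulnS addnC leq_add2r mulnC leq_trunc_div.
  exists (m * (n0 %/ m).+1)%N, (m * (n0 %/ m).+1 + D' - k - E)%N.
  rewrite dvdn_mulr //; move: K1 K2; rewrite /n0; clear n0.
  by move: (_ * _)%N => K K1 K2; split=> //; lia.
have hE : (h' <= E)%N by rewrite /E (leq_trans hm') ?leq_addr.
exists K; split=> //.
set L := (i0 + M * Q + D')%N in d0.
pose Y := d (K + D')%N L; pose y := d (k + h')%N L.
have dkL : d k L \in gint by apply: coherent_gint_join.
have dk1L : d k.+1 L \notin gint.
  by apply: contraNN dk1 => ?; apply: coherent_gint_down sd _ (leq0n L) _; last eassumption.
have Yy : P^c ^+ E * Y - y \in gint.
  by rewrite /Y hK -addnA (addnC E) addnA; exact: coherent_iterP.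
have yk : P^c ^+ h' * y - d k L \in gint by exact: coherent_iterP.
have yk1 : P^c ^+ h'.-1 * y - d k.+1 L \in gint.
  have := coherent_iterP k.+1 h'.-1 L sd; rewrite addSnnS prednK //.
  exact: leq_ltn_trans hh'.
have gy : P^c ^+ h' * y \in gint by rewrite (gint_congr yk).
have gY : P^c ^+ (2 * E) * Y \in gint.
  have -> : P^c ^+ (2 * E) * Y =
      P^c ^+ E * (P^c ^+ E * Y - y) + P^c ^+ (E - h') * (P^c ^+ h' * y).
    by rewrite mul2n -addnn !mulrA -exprD subnK // exprD; ring.
  by rewrite rpredD // rpredM // rpredX.
pose kap := P ^+ K * S ^+ i0 * beta * S^c ^+ M ^+ Q.-1.
have gkap : kap \in gint by rewrite !rpredM ?rpredX.
have ckap : copr kap P^c.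
  have cS'P' : copr S^c P^c by exact: copr_sym.
  rewrite /kap; do ![apply: coprM => //; rewrite ?rpredM ?rpredX //].
  - exact: coprXl.
  - exact: coprXl.
  - by apply: coprXl => //; rewrite ?rpredX //; apply: coprXl.
move=> tau.
have gky : kap * y * P^c ^+ h' \in gint by rewrite -mulrA rpredM // mulrC.
have cky : copr (kap * y * P^c ^+ h') P^c.
  (* If P' divided kap y P'^h', then P'^(h'-1) y would be integral, against the choice of [k]. *)
  have [[w gw e]|//] := gprime_dvd_or_copr hP gky.
  case/negP: dk1L.
  rewrite -(gint_congr yk1).
  have h'0 : h' = h'.-1.+1 by rewrite prednK // (leq_ltn_trans _ hh').
  apply: (copr_cancel ckap).
    have -> : kap * (P^c ^+ h'.-1 * y) = w; last by [].
    apply: (mulfI (gprime_conj_neq0 hP)); rewrite -e [in RHS]h'0 exprS; ring.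
  by rewrite mulrA -exprS -h'0.
have [l [lQ [g gg hg]]] := torsion_dense (P ^+ K * S ^+ i0 * S^c ^+ M ^+ Q * Y) tau gky cky.
have lQ' : (l <= Q)%N.
  by apply: ltnW (leq_trans lQ _); rewrite leq_exp2l ?prime_gt1.
exists l; split=> //.
have [g1 gg1 e1] := expand_near_power (rpredX M gS') (rpredM (rpredX E gP') gbeta) lQ'.
set V := P ^+ K * S ^+ (i0 + M * l) * d (K + D')%N (i0 + M * l + D')%N.
set C0 := P ^+ K * S ^+ i0 * S^c ^+ M ^+ Q * Y in hg.
suff VV : V - (C0 + l%:R * (kap * y)) \in gint.
  exists (g + (V - (C0 + l%:R * (kap * y)))); first exact: rpredD.
  apply: le_trans (_ : (nm P^c ^+ h')^-1 <= _).
    apply: le_trans hg; rewrite le_eqVlt; apply/orP; left; apply/eqP; congr nm; ring.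
  rewrite lef_pV2 ?posrE ?exprn_gt0 ?(lt_trans _ (gprime_nm_gt1 hP)) //.
  by apply: ler_weXn2l; [exact: ltW (gprime_nm_gt1 hP) | exact: ltnW].
have dY : S^c ^+ (M * (Q - l)) * Y - d (K + D')%N (i0 + M * l + D')%N \in gint.
  have -> : Y = d (K + D')%N (i0 + M * l + D' + M * (Q - l))%N.
    congr (d _ _); rewrite /L mulnBr; have := leq_mul (leqnn M) lQ'.
    move: (M * l)%N (M * Q)%N => a b; clear; lia.
  exact: coherent_iterS.
have {}e1 : S ^+ (M * l) * S^c ^+ (M * (Q - l)) = S^c ^+ M ^+ Q +
    l%:R * (S^c ^+ M ^+ Q.-1 * (P^c ^+ E * beta)) + (P^c ^+ E * beta) ^+ 2 * g1.
  by rewrite !exprM SME e1.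
have -> : V - (C0 + l%:R * (kap * y)) =
   - (P ^+ K * S ^+ (i0 + M * l) * (S^c ^+ (M * (Q - l)) * Y - d (K + D')%N (i0 + M * l + D')%N))
   + l%:R * kap * (P^c ^+ E * Y - y) +
   P ^+ K * S ^+ i0 * beta ^+ 2 * g1 * (P^c ^+ (2 * E) * Y).
  rewrite mulrBr opprB -/V.
  have -> : P ^+ K * S ^+ (i0 + M * l) * (S^c ^+ (M * (Q - l)) * Y) =
     P ^+ K * S ^+ i0 * (S ^+ (M * l) * S^c ^+ (M * (Q - l))) * Y by rewrite exprD; ring.
  rewrite e1 /C0 /kap mul2n -addnn (exprD _ E E); ring.
gint_tac.
Qed.

End Pair.
End Solenoid.

(** * Orbits avoiding the stripe, and their isolation transversally to the leaves *)

Section Avoiding.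
Variable R : realType.
Implicit Types (P S c z : R[i]) (p s h k l m n q : nat) (eps : R).
Implicit Types (x y d t : nat -> nat -> R[i]).
Local Notation gint := (@gint R).

(** The image of the point [c] of the plane in the solenoid; these images form the leaf of 0. *)
Definition emb P S c k l : R[i] := c / (P^c ^+ k * S^c ^+ l).

(** The number P^r S^s x r s is the coordinate (0, 0) of the image of [x] under (P/P')^r (S/S')^s;
    on [emb P S c] it equals (P/P')^r (S/S')^s c. *)
Definition avoid eps P S x :=
  forall r s (n : int), eps <= `|Re (P ^+ r * S ^+ s * x r s) - n%:~R|.

(* Modulo q-torsion, x comes from the archimedean leaf. *)
Definition leaf_mod P S q x :=
  exists c, forall k l, q%:R * (x k l - emb P S c k l) \in gint.

(** Exchanges the two primes, so that results about P' transfer to S'. *)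
Definition tr x k l := x l k.

Lemma emb_tr P S c k l : emb P S c k l = emb S P c l k.
Proof. by rewrite /emb (mulrC (P^c ^+ k)). Qed.

Lemma coherent_tr P S x : coherent P S x -> coherent S P (tr x).
Proof. by case=> h1 h2; split=> k l; [apply: h2 | apply: h1]. Qed.

Lemma avoid_tr eps P S x : avoid eps P S x -> avoid eps S P (tr x).
Proof. by move=> h r s n; rewrite (mulrC (S ^+ r)); apply: h. Qed.

Lemma prime_pair_sym P p S s : prime_pair P p S s -> prime_pair S s P p.
Proof. by case=> h1 h2 h3 h4 h5; split=> //; apply: copr_sym. Qed.

Lemma avoid_nm eps P S x r s g : avoid eps P S x -> g \in gint ->
  eps <= nm (P ^+ r * S ^+ s * x r s - g).
Proof.
move=> hx; rewrite gintE => /andP[/intrP[n hn] _].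
by apply: le_trans (nm_ge_Re _); rewrite ReD ReN hn.
Qed.

Lemma nm_powB1 (u : R[i]) l : nm u = 1 -> nm (u ^+ l - 1) <= l%:R * nm (u - 1).
Proof.
move=> u1; elim: l => [|l IH]; first by rewrite subrr nm0 mul0r.
have -> : u ^+ l.+1 - 1 = u ^+ l * (u - 1) + (u ^+ l - 1) by rewrite exprSr; ring.
apply: le_trans (nmD _ _) _.
by rewrite nmM nmX u1 expr1n mul1r -natr1 mulrDl mul1r addrC lerD2r.
Qed.

Lemma exprn_inv_small (a e : R) : 1 < a -> 0 < e -> exists h, (a ^+ h)^-1 < e.
Proof.
move=> a1 e0; have [h hh] := exprn_unbounded e^-1 a1; exists h.
by rewrite invf_plt ?posrE ?exprn_gt0 // (lt_trans _ a1).
Qed.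

Section Pair.
Variables (P S : R[i]) (p s : nat).
Hypothesis ok : prime_pair P p S s.

Let hP : gprime P p. Proof. by case: ok. Qed.
Let hS : gprime S s. Proof. by case: ok. Qed.
Let gP : P \in gint. Proof. exact: gprime_gint hP. Qed.
Let gS : S \in gint. Proof. exact: gprime_gint hS. Qed.
Let gP' : P^c \in gint. Proof. exact: gprime_conj_gint hP. Qed.
Let gS' : S^c \in gint. Proof. exact: gprime_conj_gint hS. Qed.
Let nP' : P^c != 0. Proof. exact: gprime_conj_neq0 hP. Qed.
Let nS' : S^c != 0. Proof. exact: gprime_conj_neq0 hS. Qed.

Lemma emb_coherent c : coherent P S (emb P S c).
Proof.
split=> k l; rewrite /emb.
  have -> : P^c * (c / (P^c ^+ k.+1 * S^c ^+ l)) - c / (P^c ^+ k * S^c ^+ l) = 0.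
    by rewrite exprS; field; rewrite ?expf_neq0 // ?nP' ?nS'.
  exact: gint0.
have -> : S^c * (c / (P^c ^+ k * S^c ^+ l.+1)) - c / (P^c ^+ k * S^c ^+ l) = 0.
  by rewrite exprS; field; rewrite ?expf_neq0 // ?nP' ?nS'.
exact: gint0.
Qed.

Lemma coherentB x y : coherent P S x -> coherent P S y -> coherent P S (fun k l => x k l - y k l).
Proof.
move=> [h1 h2] [h3 h4]; split=> k l.
  have -> : P^c * (x k.+1 l - y k.+1 l) - (x k l - y k l) =
    (P^c * x k.+1 l - x k l) - (P^c * y k.+1 l - y k l) by ring.
  exact: rpredB.
have -> : S^c * (x k l.+1 - y k l.+1) - (x k l - y k l) =
    (S^c * x k l.+1 - x k l) - (S^c * y k l.+1 - y k l) by ring.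
exact: rpredB.
Qed.

(** Modulo Z[i], each coordinate of a q-torsion point is S'^k0 times another one, so S'^e fixes it
    once S'^(k0+e) and S'^k0 agree modulo q. Hence S'^(e-1) inverts S' on such points, S/S' acts as
    multiplication by tau = S S'^(e-1), and the powers of [tau] are eventually periodic modulo q. *)
Lemma torsion_periodic q : (0 < q)%N -> exists i0 M, (0 < M)%N /\
  forall t, coherent P S t -> (forall k l, q%:R * t k l \in gint) ->
  forall k j, S ^+ (i0 + M * j) * t k (i0 + M * j)%N - S ^+ i0 * t k i0 \in gint.
Proof.
move=> q0; have [k0 [e [e0 [g gg hg]]]] := gint_powers_periodic q0 gS'.
pose tau := S * S^c ^+ e.-1; have gtau : tau \in gint by rewrite /tau; gint_tac.
have [i0 [M [M0 [g' gg' hg']]]] := gint_powers_periodic q0 gtau.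
exists i0, M; split=> // t st tq.
have per k l : S^c ^+ e * t k l - t k l \in gint.
  have h := coherent_iterS ok k l k0 st.
  have -> : S^c ^+ e * t k l - t k l = q%:R * t k (l + k0)%N * g
      - S^c ^+ e * (S^c ^+ k0 * t k (l + k0)%N - t k l)
      + (S^c ^+ k0 * t k (l + k0)%N - t k l).
    by rewrite mulrAC -hg exprD; ring.
  by move: (tq k (l + k0)%N) => ?; gint_tac.
have step k l : t k l.+1 - S^c ^+ e.-1 * t k l \in gint.
  have h := st.2 k l; have h' := per k l.+1.
  have -> : t k l.+1 - S^c ^+ e.-1 * t k l =
     - (S^c ^+ e * t k l.+1 - t k l.+1) + S^c ^+ e.-1 * (S^c * t k l.+1 - t k l).
    have -> : S^c ^+ e = S^c * S^c ^+ e.-1 by rewrite -exprS prednK.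
    by ring.
  by gint_tac.
have pow k l : S ^+ l * t k l - tau ^+ l * t k 0%N \in gint.
  elim: l => [|l IH]; first by rewrite !expr0 subrr; exact: gint0.
  have h := step k l.
  have -> : S ^+ l.+1 * t k l.+1 - tau ^+ l.+1 * t k 0%N =
    S ^+ l.+1 * (t k l.+1 - S^c ^+ e.-1 * t k l) +
    tau * (S ^+ l * t k l - tau ^+ l * t k 0%N) by rewrite !exprS /tau; ring.
  by gint_tac.
have cyc k j : (tau ^+ (i0 + M * j) - tau ^+ i0) * t k 0%N \in gint.
  elim: j => [|j IH]; first by rewrite muln0 addn0 subrr mul0r; exact: gint0.
  have -> : (tau ^+ (i0 + M * j.+1) - tau ^+ i0) * t k 0%N =
     tau ^+ M * ((tau ^+ (i0 + M * j) - tau ^+ i0) * t k 0%N) + q%:R * t k 0%N * g'.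
    by rewrite mulrAC -hg' mulnS !exprD; ring.
  by move: (tq k 0%N) => ?; gint_tac.
move=> k j; have h1 := pow k (i0 + M * j)%N; have h2 := pow k i0; have h3 := cyc k j.
have -> : S ^+ (i0 + M * j) * t k (i0 + M * j)%N - S ^+ i0 * t k i0 =
   (S ^+ (i0 + M * j) * t k (i0 + M * j)%N - tau ^+ (i0 + M * j) * t k 0%N)
   - (S ^+ i0 * t k i0 - tau ^+ i0 * t k 0%N)
   + (tau ^+ (i0 + M * j) - tau ^+ i0) * t k 0%N by ring.
by gint_tac.
Qed.

Lemma period_mul H M j : (exists2 g, g \in gint & S ^+ M - S^c ^+ M = P^c ^+ H * g) ->
  exists2 g, g \in gint & S ^+ (M * j) - S^c ^+ (M * j) = P^c ^+ H * g.
Proof.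
move=> [g gg e].
exists (g * \sum_(i < j) (S ^+ M) ^+ (j.-1 - i) * (S^c ^+ M) ^+ i).
  apply: gintM => //; rewrite rpred_sum // => i _; gint_tac.
by rewrite !exprM subrXX e mulrA.
Qed.

(* If a deviation d from the leaf survives, the core lemma moves the orbit of x
   close to 0: along the chosen powers of S/S' the torsion part is constant
   and the archimedean part almost constant. *)
Lemma half_isolated eps q (R0 : R) : 0 < eps -> (0 < q)%N -> 0 <= R0 ->
  exists D, forall x d c, coherent P S x -> avoid eps P S x -> coherent P S d -> nm c <= R0 ->
   (forall k l, q%:R * (x k l - emb P S c k l - d k l) \in gint) ->
   d D D \in gint -> forall N, d N 0%N \in gint.
Proof.
move=> eps0 q0 R00.
have e2 : 0 < eps / 2 by rewrite divr_gt0.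
have [h hh] := exprn_inv_small (gprime_nm_gt1 hP) e2.
pose Q := (p ^ (h + 1))%N.
have [i0 [M1 [M10 hM1]]] := torsion_periodic q0.
have [M2 [M20 hM2]] := prime_power_period ok (h + 1).
have nb : nm (S / S^c) = 1 by rewrite nmM nmV nm_conjc divff // nm_eq0 (gprime_neq0 hS).
(* A rotation this close to 1, iterated at most [Q] times, moves a point of norm at most [R0] by
   less than eps/2. *)
have dl0 : 0 < eps / 2 / ((R0 + 1) * Q.+1%:R).
  by rewrite divr_gt0 // mulr_gt0 ?ltr0n // ltr_wpDl.
have [|M3 [M30 hM3]] := unit_powers_recur (u := (S / S^c) ^+ (M1 * M2)) _ dl0.
  by rewrite nmX nb expr1n.
(* [M] is at once a torsion period, a period modulo P'^(h+1) and a near-return time of the rotation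
   S/S'. *)
pose M := (M2 * (M1 * M3))%N.
have M0 : (0 < M)%N by rewrite !muln_gt0 M10 M20.
exists (i0 + M * Q + 0)%N => x d c sx ax sd hc hq hd N.
apply: contrapT => /negP dN.
have d1 : d 0%N (i0 + M * Q + 0)%N \in gint by apply: (coherent_gint_down ok sd _ _ hd).
have d2 : d 0%N 0%N \in gint by apply: (coherent_gint_down ok sd _ _ hd).
have [K [_ HK]] := core ok (ltn0Sn 0) M0 (period_mul (M1 * M3) hM2) sd d1 d2
  (ex_intro _ N dN).
pose t k l := x k l - emb P S c k l - d k l.
have st : coherent P S t by apply: coherentB => //; apply: coherentB => //; exact: emb_coherent.
(* The target cancels the archimedean and torsion parts, so that the orbit of [x] itself comes close
   to Z[i]. *)
have [l [lQ [g gg hg]]] := HK (- (P ^+ K * S ^+ i0 * emb P S c K i0 + P ^+ K * S ^+ i0 * t K i0)).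
rewrite !addn0 in hg.
have ht := hM1 _ st hq K (M2 * M3 * l)%N.
have eM : (M1 * (M2 * M3 * l) = M * l)%N by rewrite /M; ring.
rewrite eM in ht.
set i1 := (i0 + M * l)%N in hg ht.
pose g' := g + P ^+ K * (S ^+ i1 * t K i1 - S ^+ i0 * t K i0).
have gg' : g' \in gint by rewrite /g'; gint_tac.
have := avoid_nm K i1 ax gg'.
have -> : P ^+ K * S ^+ i1 * x K i1 - g' =
  (P ^+ K * S ^+ i1 * d K i1 + (P ^+ K * S ^+ i0 * emb P S c K i0 + P ^+ K * S ^+ i0 * t K i0) - g)
  + (P ^+ K * S ^+ i1 * emb P S c K i1 - P ^+ K * S ^+ i0 * emb P S c K i0).
  by rewrite /g' /t; ring.
apply/negP; rewrite -ltNge [eps]splitr.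
apply: le_lt_trans (nmD _ _) _; apply: ltrD.
  by rewrite opprK in hg; apply: le_lt_trans hg hh.
have -> : P ^+ K * S ^+ i1 * emb P S c K i1 - P ^+ K * S ^+ i0 * emb P S c K i0 =
  (P / P^c) ^+ K * (S / S^c) ^+ i0 * c * ((S / S^c) ^+ (M * l) - 1).
  rewrite /emb /i1 !exprD !exprMn !exprVn; field.
  by rewrite !expf_neq0.
have nbP : nm (P / P^c) = 1 by rewrite nmM nmV nm_conjc divff // nm_eq0 (gprime_neq0 hP).
rewrite !nmM !nmX nb nbP !expr1n !mul1r.
have hu : nm ((S / S^c) ^+ (M * l) - 1) <= l%:R * (eps / 2 / ((R0 + 1) * Q.+1%:R)).
  rewrite exprM; apply: le_trans (nm_powB1 _ _) _; first by rewrite nmX nb expr1n.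
  rewrite ler_wpM2l //; apply: ltW; move: hM3; rewrite -exprM.
  by have -> : (M1 * M2 * M3 = M)%N by rewrite /M; ring.
apply: le_lt_trans (ler_pM (nm_ge0 _) (nm_ge0 _) hc hu) _.
have -> : R0 * (l%:R * (eps / 2 / ((R0 + 1) * Q.+1%:R))) =
    (eps / 2) * ((R0 / (R0 + 1)) * (l%:R / Q.+1%:R)).
  have : R0 + 1 != 0 by rewrite gt_eqF // ltr_wpDl.
  have : Q.+1%:R != 0 :> R by rewrite pnatr_eq0.
  by move: (Q.+1%:R) (l%:R) => v w ? ?; field; apply/andP.
rewrite -[ltRHS]mulr1 ltr_pM2l //.
have a1 : R0 / (R0 + 1) < 1 by rewrite ltr_pdivrMr ?mul1r ?ltrDl // ltr_wpDl.
have a2 : l%:R / Q.+1%:R <= 1 :> R.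
  by rewrite ler_pdivrMr ?ltr0n // mul1r ler_nat leqW.
apply: le_lt_trans a1; rewrite -[leRHS]mulr1 ler_wpM2l // divr_ge0 // addr_ge0 //.
Qed.

End Pair.
End Avoiding.

(** * The Furstenberg argument *)

Section Furstenberg.
Variable R : realType.
Implicit Types (c z : R[i]) (h i j k l m n q r : nat) (eps e eta : R).
Implicit Types (x y d t : nat -> nat -> R[i]).
Local Notation gint := (@gint R).

(** The action of (P/P')^i (S/S')^j: multiplication by P/P' replaces the coordinate at level k by P
    times the one at level k + 1. *)
Definition shift (P S : R[i]) i j x k l := P ^+ i * S ^+ j * x (k + i)%N (l + j)%N.

(** * The leaf of 0 and its torsion translates *)

Section Leaves.
Variables (P S : R[i]) (p s : nat).
Hypothesis ok : prime_pair P p S s.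

Let hP : gprime P p. Proof. by case: ok. Qed.
Let hS : gprime S s. Proof. by case: ok. Qed.
Let gP : P \in gint. Proof. exact: gprime_gint hP. Qed.
Let gS : S \in gint. Proof. exact: gprime_gint hS. Qed.
Let gP' : P^c \in gint. Proof. exact: gprime_conj_gint hP. Qed.
Let gS' : S^c \in gint. Proof. exact: gprime_conj_gint hS. Qed.
Let nP' : P^c != 0. Proof. exact: gprime_conj_neq0 hP. Qed.
Let nS' : S^c != 0. Proof. exact: gprime_conj_neq0 hS. Qed.
Let nP : P != 0. Proof. exact: gprime_neq0 hP. Qed.
Let nS : S != 0. Proof. exact: gprime_neq0 hS. Qed.

(** [half_isolated] treats each prime separately, the second one through [tr]; [coherent_gint_join]
    combines the two. *)
Lemma isolated eps q (R0 : R) : 0 < eps -> (0 < q)%N -> 0 <= R0 ->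
  exists D, forall x d c, coherent P S x -> avoid eps P S x -> coherent P S d -> nm c <= R0 ->
   (forall k l, q%:R * (x k l - emb P S c k l - d k l) \in gint) ->
   d D D \in gint -> forall k l, d k l \in gint.
Proof.
move=> e0 q0 R00.
have [D1 H1] := half_isolated ok e0 q0 R00.
have [D2 H2] := half_isolated (prime_pair_sym ok) e0 q0 R00.
exists (maxn D1 D2) => x d c sx ax sd hc hq hd k l.
apply: (coherent_gint_join ok sd).
  apply: (H1 x d c) => //.
  by apply: (coherent_gint_down ok sd _ _ hd); rewrite leq_maxl.
apply: (H2 (tr x) (tr d) c (coherent_tr sx) (avoid_tr ax) (coherent_tr sd) hc _ _ l).
  by move=> k' l'; rewrite -emb_tr; apply: hq.
by apply: (coherent_gint_down ok sd _ _ hd); rewrite leq_maxr.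
Qed.

Lemma nm_emb c k l : nm (emb P S c k l) <= nm c.
Proof.
rewrite /emb nmM nmV ler_piMr ?nm_ge0 // invf_le1.
  rewrite nmM !nmX -[1]mulr1 ler_pM // exprn_ege1 // ltW //.
    exact: gprime_nm_gt1 hP.
  exact: gprime_nm_gt1 hS.
by rewrite nm_gt0 mulf_neq0 ?expf_neq0.
Qed.

Lemma embK c k l : emb P S (c * (P^c ^+ k * S^c ^+ l)) k l = c.
Proof. by rewrite /emb mulfK // mulf_neq0 ?expf_neq0. Qed.

Lemma embD c c' k l : emb P S (c + c') k l = emb P S c k l + emb P S c' k l.
Proof. exact: mulrDl. Qed.

(** The difference of [y] and [x] splits into a small displacement [c1] along the leaf and a
    deviation [d] that is integral at level (D, D); [isolated] makes [d] trivial everywhere. *)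
Lemma leaf_open eps q x : 0 < eps -> (0 < q)%N -> coherent P S x -> leaf_mod P S q x ->
  exists D eta, 0 < eta /\ forall y, coherent P S y -> avoid eps P S y ->
    (exists2 g, g \in gint & nm (y D D - x D D - g) < eta) -> leaf_mod P S q y.
Proof.
move=> e0 q0 sx [c hc].
have R00 : 0 <= nm c + 1 by rewrite addr_ge0 ?nm_ge0.
have [D HD] := isolated e0 q0 R00.
have w0 : 0 < nm (P^c ^+ D * S^c ^+ D) by rewrite nm_gt0 mulf_neq0 ?expf_neq0.
exists D, (nm (P^c ^+ D * S^c ^+ D))^-1; rewrite invr_gt0; split=> // y sy ay [g gg hg].
pose c1 := (y D D - x D D - g) * (P^c ^+ D * S^c ^+ D).
pose d k l := y k l - x k l - emb P S c1 k l.
have dg : forall k l, d k l \in gint.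
  apply: (HD y d (c + c1)) => //.
  - by apply: coherentB; [exact: coherentB | exact: (emb_coherent ok)].
  - apply: le_trans (nmD _ _) _; rewrite lerD2l /c1 nmM.
    by rewrite -ler_pdivlMr // div1r ltW.
  - move=> k l; have -> : y k l - emb P S (c + c1) k l - d k l = x k l - emb P S c k l.
      by rewrite embD /d; ring.
    exact: hc.
  - by rewrite /d /c1 embK opprB addrCA subrr addr0.
exists (c + c1) => k l.
have -> : q%:R * (y k l - emb P S (c + c1) k l) =
   q%:R * (x k l - emb P S c k l) + q%:R * d k l by rewrite embD /d; ring.
by move: (hc k l) (dg k l) => ? ?; gint_tac.
Qed.

(** A nonzero Gaussian integer divides a positive integer, so torsion killed by [nu] is killed by
    some [q]. *)
Lemma leaf_of_gint (nu : R[i]) c x : nu \in gint -> nu != 0 ->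
  (forall k l, nu * x k l - emb P S c k l \in gint) ->
  exists q, (0 < q)%N /\ leaf_mod P S q x.
Proof.
move=> gnu nu0 H; have [q [y [q0 gy e]]] := gint_annihilator gnu nu0.
exists q; split=> //; exists (c / nu) => k l.
have -> : q%:R * (x k l - emb P S (c / nu) k l) = y * (nu * x k l - emb P S c k l).
  rewrite -e /emb; field.
  by rewrite nu0 !expf_neq0.
by apply: gintM.
Qed.

(** Multiplying by P'^i S'^j turns the shifted point into P^i S^j x modulo Z[i], and [leaf_of_gint]
    absorbs the Gaussian coefficient. *)
Lemma leaf_shift q i j x : (0 < q)%N -> coherent P S x -> leaf_mod P S q (shift P S i j x) ->
  exists q', (0 < q')%N /\ leaf_mod P S q' x.
Proof.
move=> q0 sx [c hc].
apply: (@leaf_of_gint (q%:R * (P ^+ i * S ^+ j)) (q%:R * c * (P^c ^+ i * S^c ^+ j))).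
- by gint_tac.
- by rewrite !mulf_neq0 ?expf_neq0 // pnatr_eq0 -lt0n.
move=> k l; have h1 := hc k l; have h2 := coherent_iter ok sx i j k l.
have -> : q%:R * (P ^+ i * S ^+ j) * x k l - emb P S (q%:R * c * (P^c ^+ i * S^c ^+ j)) k l =
   P^c ^+ i * S^c ^+ j * (q%:R * (shift P S i j x k l - emb P S c k l)) -
   q%:R * (P ^+ i * S ^+ j) * (P^c ^+ i * S^c ^+ j * x (k + i)%N (l + j)%N - x k l).
  by rewrite /shift /emb; ring.
by gint_tac.
Qed.

Lemma leaf_dvd q q' x : (q %| q')%N -> leaf_mod P S q x -> leaf_mod P S q' x.
Proof.
move=> /dvdnP[n ->] [c hc]; exists c => k l.
by rewrite natrM -mulrA; move: (hc k l) => ?; gint_tac.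
Qed.

Lemma coherent_shift i j x : coherent P S x -> coherent P S (shift P S i j x).
Proof.
move=> [h1 h2]; split=> k l; rewrite /shift.
  have -> : P^c * (P ^+ i * S ^+ j * x (k.+1 + i)%N (l + j)%N)
      - P ^+ i * S ^+ j * x (k + i)%N (l + j)%N =
    P ^+ i * S ^+ j * (P^c * x (k + i).+1 (l + j)%N - x (k + i)%N (l + j)%N).
    by rewrite addSn; ring.
  by move: (h1 (k + i)%N (l + j)%N) => ?; gint_tac.
have -> : S^c * (P ^+ i * S ^+ j * x (k + i)%N (l.+1 + j)%N)
      - P ^+ i * S ^+ j * x (k + i)%N (l + j)%N =
    P ^+ i * S ^+ j * (S^c * x (k + i)%N (l + j).+1 - x (k + i)%N (l + j)%N).
  by rewrite addSn; ring.
by move: (h2 (k + i)%N (l + j)%N) => ?; gint_tac.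
Qed.

Lemma avoid_shift eps i j x : avoid eps P S x -> avoid eps P S (shift P S i j x).
Proof.
move=> h r u n; rewrite /shift.
have -> : P ^+ r * S ^+ u * (P ^+ i * S ^+ j * x (r + i)%N (u + j)%N) =
  P ^+ (r + i) * S ^+ (u + j) * x (r + i)%N (u + j)%N by rewrite !exprD; ring.
exact: h.
Qed.

Lemma avoid_congr eps x y : (forall k l, x k l - y k l \in gint) ->
  avoid eps P S x -> avoid eps P S y.
Proof.
move=> h hx r u n.
have : P ^+ r * S ^+ u * (x r u - y r u) \in gint by move: (h r u) => ?; gint_tac.
rewrite gintE => /andP[/intrP[m hm] _].
have := hx r u (n + m).
have -> : P ^+ r * S ^+ u * x r u =
  P ^+ r * S ^+ u * y r u + P ^+ r * S ^+ u * (x r u - y r u) by ring.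
rewrite ReD hm intrD; congr (_ <= `| _ |); ring.
Qed.

(** Multiplied by P'^(i+n), the return relation places P^i (P^n - P'^n) x on the leaf of 0, and this
    coefficient is nonzero by [copr_pow_neq]. *)
Lemma leaf_of_return i n c x : (0 < n)%N -> coherent P S x ->
  (forall k l, shift P S (i + n) 0 x k l - shift P S i 0 x k l - emb P S c k l \in gint) ->
  exists q, (0 < q)%N /\ leaf_mod P S q x.
Proof.
move=> n0 sx H.
apply: (@leaf_of_gint (P ^+ i * (P ^+ n - P^c ^+ n)) (P^c ^+ (i + n) * c)).
- by gint_tac.
- rewrite mulf_neq0 ?expf_neq0 // subr_eq0; apply: copr_pow_neq => //.
  + by case: hP.
  + by rewrite gt_eqF // (gprime_nm_gt1 hP).
  + by rewrite nm_conjc.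
move=> k l; have h0 := H k l.
have h1 := coherent_iterP ok k (i + n) l sx; have h2 := coherent_iterP ok k i l sx.
have -> : P ^+ i * (P ^+ n - P^c ^+ n) * x k l - emb P S (P^c ^+ (i + n) * c) k l =
  P^c ^+ (i + n) * (shift P S (i + n) 0 x k l - shift P S i 0 x k l - emb P S c k l)
  - P ^+ (i + n) * (P^c ^+ (i + n) * x (k + (i + n))%N l - x k l)
  + P^c ^+ n * P ^+ i * (P^c ^+ i * x (k + i)%N l - x k l).
  by rewrite /shift /emb !addn0 !exprD !expr0; ring.
by gint_tac.
Qed.

(** The form of [core] used for density: both exponents are multiples of [m], as suits a set
    invariant under m-th powers only. *)
Lemma expansion m D' eta : (0 < m)%N -> 0 < eta ->
  exists D, forall d, coherent P S d -> d D D \in gint -> (exists N, d N 0%N \notin gint) ->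
  forall tau, exists K L, [/\ (m %| K)%N, (m %| L)%N & exists2 g, g \in gint &
    nm (P ^+ K * S ^+ L * d (K + D')%N (L + D')%N - tau - g) < eta].
Proof.
move=> m0 eta0.
have [h hh] := exprn_inv_small (gprime_nm_gt1 hP) eta0.
have [M [M0 hM]] := prime_power_period ok (h + m).
have Mm0 : (0 < M * m)%N by rewrite muln_gt0 M0.
exists (0 + M * m * p ^ (h + m) + D')%N => d sd hd hN tau.
have d1 : d 0%N (0 + M * m * p ^ (h + m) + D')%N \in gint.
  exact: (coherent_gint_down ok sd _ _ hd).
have d2 : d D' 0%N \in gint.
  by apply: (coherent_gint_down ok sd _ _ hd) => //; exact: leq_addl.
have [K [mK HK]] := core ok m0 Mm0 (period_mul ok m hM) sd d1 d2 hN.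
have [l [_ [g gg hg]]] := HK tau.
exists K, (0 + M * m * l)%N; split=> //.
  by rewrite add0n mulnAC dvdn_mull.
by exists g => //; apply: le_lt_trans hg hh.
Qed.
End Leaves.

(** * Limits in the solenoid *)

Section Limits.
Variable U : set_system nat.
Hypothesis UU : UltraFilter U.
Hypothesis UN : forall N, U [set n | (N <= n)%N].
Implicit Types X Y : nat -> nat -> nat -> R[i].

(** Coordinatewise convergence modulo Z[i], that is, convergence in the topology of the solenoid. *)
Definition conv X x := forall k l e, 0 < e ->
  U [set j | exists2 g, g \in gint & nm (X j k l - x k l - g) < e].

Lemma conv_exists X : exists x, conv X x.
Proof.
have H (kl : nat * nat) : {a : R[i] | forall e, 0 < e ->
    U [set j | exists2 g, g \in gint & nm (X j kl.1 kl.2 - a - g) < e]}.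
  exact/cid/ultra_cvg_mod.
by exists (fun k l => sval (H (k, l))) => k l; exact: (svalP (H (k, l))).
Qed.

Lemma conv_add X x t : conv X x ->
  conv (fun j k l => X j k l + t k l) (fun k l => x k l + t k l).
Proof.
move=> h k l e e0; apply: filterS (h k l e e0) => j [g gg hg]; exists g => //.
by rewrite opprD addrACA subrr addr0.
Qed.

Variables (P S : R[i]) (p s : nat).
Hypothesis ok : prime_pair P p S s.

Let hP : gprime P p. Proof. by case: ok. Qed.
Let hS : gprime S s. Proof. by case: ok. Qed.
Let gP : P \in gint. Proof. exact: gprime_gint hP. Qed.
Let gS : S \in gint. Proof. exact: gprime_gint hS. Qed.
Let gP' : P^c \in gint. Proof. exact: gprime_conj_gint hP. Qed.
Let gS' : S^c \in gint. Proof. exact: gprime_conj_gint hS. Qed.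
Let nP' : P^c != 0. Proof. exact: gprime_conj_neq0 hP. Qed.
Let nS' : S^c != 0. Proof. exact: gprime_conj_neq0 hS. Qed.
Let nP : P != 0. Proof. exact: gprime_neq0 hP. Qed.
Let nS : S != 0. Proof. exact: gprime_neq0 hS. Qed.

Lemma conv_gint_comb X x (a : R[i]) k l k' l' : a \in gint -> conv X x ->
  (forall j, a * X j k l - X j k' l' \in gint) -> a * x k l - x k' l' \in gint.
Proof.
move=> ga hc H; apply: gint_closed => e e0.
have d0 : 0 < e / 2 / (nm a + 1) by rewrite !divr_gt0 // ltr_wpDl ?nm_ge0.
have e2 : 0 < e / 2 by rewrite divr_gt0.
have [j [[g gg h1] [g' gg' h2]]] := filter_ex (filterI (hc k l _ d0) (hc k' l' _ e2)).
exists (a * X j k l - X j k' l' - a * g + g').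
  by move: (H j) => ?; gint_tac.
have -> : a * x k l - x k' l' - (a * X j k l - X j k' l' - a * g + g') =
  - (a * (X j k l - x k l - g)) + (X j k' l' - x k' l' - g') by ring.
apply: le_lt_trans (nmD _ _) _; rewrite [e]splitr; apply: ler_ltD => //.
rewrite nmN nmM; apply: le_trans (_ : (nm a + 1) * (e / 2 / (nm a + 1)) <= _).
  by apply: ler_pM; rewrite ?nm_ge0 ?lerDl //; exact: ltW.
by rewrite mulrCA divff ?mulr1 // gt_eqF // ltr_wpDl // nm_ge0.
Qed.

Lemma conv_coherent X x : (forall j, coherent P S (X j)) -> conv X x -> coherent P S x.
Proof.
move=> hX hc; split=> k l; apply: (conv_gint_comb _ hc) => // j; [exact: (hX j).1|exact: (hX j).2].
Qed.

(** The bound is asked for each (r, u) separately because in [cover] the j-th point satisfies it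
    only for exponents up to j + 1. *)
Lemma conv_avoid eps X x : conv X x ->
  (forall r u, U [set j | forall n : int,
     eps <= `|Re (P ^+ r * S ^+ u * X j r u) - n%:~R|]) -> avoid eps P S x.
Proof.
move=> hc H r u n; rewrite leNgt; apply/negP => hlt.
set a := P ^+ r * S ^+ u in hlt.
have a0 : a != 0 by rewrite mulf_neq0 ?expf_neq0.
have ga : a \in gint by rewrite /a; gint_tac.
have na : 0 < nm a by rewrite nm_gt0.
have d0 : 0 < (eps - `|Re (a * x r u) - n%:~R|) / nm a by rewrite divr_gt0 // subr_gt0.
have [j [[g gg h1] h2]] := filter_ex (filterI (hc r u _ d0) (H r u)).
have : a * g \in gint by gint_tac.
rewrite gintE => /andP[/intrP[m hm] _].
have := h2 (n + m); rewrite -/a leNgt => /negP; apply.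
have -> : a * X j r u = a * x r u + a * (X j r u - x r u - g) + a * g by ring.
rewrite !ReD hm intrD.
set A := Re (a * x r u) in d0 h1 hlt *; set B := Re (a * _).
have -> : A + B + m%:~R - (n%:~R + m%:~R) = (A - n%:~R) + B by ring.
apply: le_lt_trans (ler_normD _ _) _; rewrite addrC -ltrBrDr.
apply: le_lt_trans (nm_ge_Re _) _.
by rewrite nmM mulrC -ltr_pdivlMr.
Qed.

(** * Differences of a closed invariant set disjoint from the leaves *)

Section MinimalSets.
Variable m : nat.
Hypothesis m0 : (0 < m)%N.
Variable E : (nat -> nat -> R[i]) -> Prop.
Hypothesis Ecoherent : forall x, E x -> coherent P S x.
Hypothesis Eleaf : forall x q, (0 < q)%N -> E x -> ~ leaf_mod P S q x.
Hypothesis Eshift : forall x i j, E x -> E (shift P S (m * i) (m * j) x).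
Hypothesis Econv : forall X x, (forall j, E (X j)) -> conv X x -> E x.
Hypothesis Ex : exists x, E x.

(** By recurrence two iterates [x], [y] of [x0] nearly agree at level (D, D). Their difference is a
    small leaf displacement [c1] plus a deviation [d]; [expansion] carries [d] to the target while
    [c1] is only rotated and stays small. *)
Lemma difference_approx D' eta tau : 0 < eta ->
  exists x y, [/\ E x, E y & exists2 g, g \in gint & nm (x D' D' - y D' D' - tau - g) < eta].
Proof.
move=> eta0; have [x0 hx0] := Ex.
have e2 : 0 < eta / 2 by rewrite divr_gt0.
have [D1 H1] := expansion ok D' m0 e2.
have [D2 H2] := expansion (prime_pair_sym ok) D' m0 e2.
pose D := maxn D1 D2.
have w0 : 0 < nm (P^c ^+ D * S^c ^+ D) by rewrite nm_gt0 mulf_neq0 ?expf_neq0.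
have e3 : 0 < eta / 2 / nm (P^c ^+ D * S^c ^+ D) by rewrite divr_gt0.
have [i [j [ij [g gg hg]]]] := gint_recurrence (fun i => shift P S (m * i) (m * 0) x0 D D) e3.
set x := shift P S (m * j) (m * 0) x0 in hg.
set y := shift P S (m * i) (m * 0) x0 in hg.
have hx : E x by exact: Eshift.
have hy : E y by exact: Eshift.
pose c1 := (x D D - y D D - g) * (P^c ^+ D * S^c ^+ D).
have hc1 : nm c1 < eta / 2 by rewrite /c1 nmM -ltr_pdivlMr.
pose d k l := x k l - y k l - emb P S c1 k l.
have sd : coherent P S d by apply: coherentB; [apply: coherentB; exact: Ecoherent | exact: (emb_coherent ok)].
have dD : d D D \in gint by rewrite /d /c1 (embK ok) opprB addrCA subrr addr0.
suff [K [L [mK mL [g' gg' hg']]]] : exists K L, [/\ (m %| K)%N, (m %| L)%N &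
    exists2 g, g \in gint & nm (P ^+ K * S ^+ L * d (K + D')%N (L + D')%N - tau - g) < eta / 2].
  exists (shift P S K L x), (shift P S K L y); split.
  - by move/dvdnP: mK mL => [a ->] /dvdnP[b ->]; rewrite !(mulnC _ m); exact: Eshift.
  - by move/dvdnP: mK mL => [a ->] /dvdnP[b ->]; rewrite !(mulnC _ m); exact: Eshift.
  exists g' => //.
  have -> : shift P S K L x D' D' - shift P S K L y D' D' - tau - g' =
    (P ^+ K * S ^+ L * d (K + D')%N (L + D')%N - tau - g') +
    P ^+ K * S ^+ L * emb P S c1 (K + D')%N (L + D')%N.
    by rewrite /d /shift !(addnC D'); ring.
  apply: le_lt_trans (nmD _ _) _; rewrite [eta]splitr; apply: ltrD => //.
  apply: le_lt_trans hc1; apply: le_trans (nm_emb ok c1 D' D').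
  rewrite /emb !nmM !nmV !nmM !nmX !nm_conjc !exprD.
  have := nP; have := nS; rewrite -!nm_eq0 => n1 n2.
  rewrite le_eqVlt; apply/orP; left; apply/eqP; field.
  by rewrite !expf_neq0.
(* If [d] were trivial, [x0] would lie on a torsion translate of the leaf, which [Eleaf] excludes.
   Otherwise [d] is nontrivial along P' or along S'. *)
have [allg|nall] := pselect (forall k l, d k l \in gint).
  have [||q [q0]] := @leaf_of_return _ _ _ _ ok (m * i) (m * (j - i)) c1 x0 _ (Ecoherent hx0).
  - by rewrite muln_gt0 m0 subn_gt0.
  - move=> k l; rewrite -mulnDr subnKC ?(ltnW ij) //.
    by have := allg k l; rewrite /d /x /y muln0.
  by move/(Eleaf q0 hx0).
have [[N hN]|n1] := pselect (exists N, d N 0%N \notin gint).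
  apply: H1 => //; last by exists N.
  by apply: (coherent_gint_down ok sd _ _ dD); rewrite leq_maxl.
have [[N hN]|n2] := pselect (exists N, d 0%N N \notin gint).
  have dD2 : tr d D2 D2 \in gint by apply: (coherent_gint_down ok sd _ _ dD); rewrite leq_maxr.
  have [K [L [mK mL h]]] := H2 (tr d) (coherent_tr sd) dD2 (ex_intro _ N hN) tau.
  exists L, K; split=> //; case: h => g' gg' hg'; exists g' => //.
  by rewrite (mulrC (P ^+ L)).
case: nall => k l; apply: (coherent_gint_join ok sd); apply: contrapT => /negP h.
  by apply: n1; exists k.
by apply: n2; exists l.
Qed.

(** Passing from level (j, j) to a lower one multiplies errors by at most [w j], so an error
    1/((j+1) w j) there controls all lower levels within 1/(j+1). Limits then give equality modulo
    Z[i]. *)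
Lemma difference_all t : coherent P S t ->
  exists x y, [/\ E x, E y & forall k l, x k l - y k l - t k l \in gint].
Proof.
move=> st.
pose w j := nm (P^c ^+ j * S^c ^+ j).
have w0 j : 0 < w j by rewrite nm_gt0 mulf_neq0 ?expf_neq0.
have H j : exists xy : (nat -> nat -> R[i]) * (nat -> nat -> R[i]),
    [/\ E xy.1, E xy.2 & exists2 g, g \in gint &
       nm (xy.1 j j - xy.2 j j - t j j - g) < (j.+1%:R * w j)^-1].
  have e0 : 0 < (j.+1%:R * w j)^-1 by rewrite invr_gt0 mulr_gt0 // ltr0n.
  by have [x [y [h1 h2 h3]]] := difference_approx j (t j j) e0; exists (x, y).
have [Z HZ] := choice H.
have [x hx] := conv_exists (fun j => (Z j).1).
have [y hy] := conv_exists (fun j => (Z j).2).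
exists x, y; split.
- by apply: Econv hx => j; case: (HZ j).
- by apply: Econv hy => j; case: (HZ j).
move=> k l; apply: gint_closed => e e0.
have e3 : 0 < e / 3 by rewrite divr_gt0.
have [j [[[g1 gg1 h1] [g2 gg2 h2]] /= hj]] := filter_ex (filterI (filterI (hx k l _ e3)
  (hy k l _ e3)) (UN (maxn (maxn k l) (Num.truncn (e / 3)^-1)))).
move: hj; rewrite !geq_max => /andP[/andP[kj lj] tj].
have [E1 E2 [g gg hg]] := HZ j.
pose u k l := (Z j).1 k l - (Z j).2 k l - t k l.
have su : coherent P S u by apply: coherentB => //; apply: coherentB; exact: Ecoherent.
have hu := coherent_iter ok su (j - k) (j - l) k l; rewrite !subnKC // in hu.
set a := P^c ^+ (j - k) * S^c ^+ (j - l) in hu.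
have ga : a \in gint by rewrite /a; gint_tac.
exists (a * g - (a * u j j - u k l) - g1 + g2); first by gint_tac.
have -> : x k l - y k l - t k l - (a * g - (a * u j j - u k l) - g1 + g2) =
  a * (u j j - g) - ((Z j).1 k l - x k l - g1) + ((Z j).2 k l - y k l - g2).
  by rewrite /u; ring.
have ha : nm (a * (u j j - g)) <= e / 3.
  rewrite nmM; apply: le_trans (_ : w j * (j.+1%:R * w j)^-1 <= _).
    apply: ler_pM; rewrite ?nm_ge0 //; last exact: ltW.
    rewrite /a /w !nmM !nmX; apply: ler_pM; rewrite ?exprn_ge0 ?nm_ge0 //.
      by apply: ler_weXn2l; [exact: ltW (gprime_nm_gt1 hP) | exact: leq_subr].
    by apply: ler_weXn2l; [exact: ltW (gprime_nm_gt1 hS) | exact: leq_subr].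
  rewrite invfM mulrCA divff ?mulr1 ?gt_eqF //.
  rewrite invf_ple ?posrE ?ltr0n //; apply: ltW.
  by apply: lt_le_trans (truncnS_gt _) _; rewrite ler_nat ltnS.
apply: le_lt_trans (nmD _ _) _.
have -> : e = e / 3 + e / 3 + e / 3 by field.
apply: ltrD => //; apply: le_lt_trans (nmD _ _) _; rewrite nmN; exact: ler_ltD.
Qed.

End MinimalSets.
End Limits.
End Furstenberg.

(** * Covering the plane *)

Section Covering.
Variable R : realType.
Implicit Types (c z : R[i]) (h i j k l m n q r : nat) (eps e : R).
Implicit Types (x y d t : nat -> nat -> R[i]).
Local Notation gint := (@gint R).

Lemma gint_pow_sub1 q (a : R[i]) n : a \in gint ->
  (exists2 g, g \in gint & a - 1 = q%:R * g) ->
  exists2 g, g \in gint & a ^+ n - 1 = q%:R * g.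
Proof.
move=> ga [g gg e]; exists (g * \sum_(i < n) a ^+ (n.-1 - i) * 1 ^+ i).
  by apply: gintM => //; rewrite rpred_sum // => i _; gint_tac.
by rewrite -[X in _ - X](expr1n _ n) subrXX e mulrA.
Qed.

(** Eventual periodicity modulo [q] is pure periodicity because [a] is invertible there. *)
Lemma copr_pow_eq1 q (a : R[i]) : (0 < q)%N -> a \in gint -> copr a q%:R ->
  exists m, (0 < m)%N /\ exists2 g, g \in gint & a ^+ m - 1 = q%:R * g.
Proof.
move=> q0 ga ca; have [i0 [m [m0 [g gg e]]]] := gint_powers_periodic q0 ga.
exists m; split=> //; apply: (@copr_dvd _ _ (a ^+ i0) _ g) => //.
- by apply: copr_sym; apply: coprXl => //; gint_tac.
- by gint_tac.
- by rewrite mulrBr mulr1 -exprD.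
Qed.

(* A rotation by an irrational angle has bounded Birkhoff sums, so the real
   part must change sign, and it does so in small steps. *)
Lemma rotation_small_Re (u c : R[i]) e : nm u = 1 ->
  (forall M, (0 < M)%N -> u ^+ M != 1) -> 0 < e -> exists r, `|Re (u ^+ r * c)| < e.
Proof.
move=> nu hu e0; apply: contrapT => none.
have big r : e <= `|Re (u ^+ r * c)|.
  by rewrite leNgt; apply/negP => h; apply: none; exists r.
(* Steps by b = u^M change the real part by less than [e], so it cannot jump from at least e to at
   most -e. *)
have d0 : 0 < e / (nm c + 1) by rewrite divr_gt0 // ltr_wpDl ?nm_ge0.
have [M [M0 hM]] := unit_powers_recur nu d0.
set b := u ^+ M in hM.
have nb : nm b = 1 by rewrite /b nmX nu expr1n.
have b1 : b - 1 != 0 by rewrite subr_eq0 hu.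
have step j : `|Re (b ^+ j.+1 * c) - Re (b ^+ j * c)| < e.
  rewrite -ReN -ReD; apply: le_lt_trans (nm_ge_Re _) _.
  have -> : b ^+ j.+1 * c - b ^+ j * c = b ^+ j * (b - 1) * c by rewrite exprS; ring.
  rewrite !nmM nmX nb expr1n mul1r.
  apply: le_lt_trans (_ : nm (b - 1) * (nm c + 1) < _).
    by rewrite ler_wpM2l ?nm_ge0 // lerDl.
  by rewrite -ltr_pdivlMr // ltr_wpDl ?nm_ge0.
have bigb j : e <= `|Re (b ^+ j * c)| by rewrite /b -exprM.
wlog pos : c none big d0 hM step bigb / 0 <= Re c.
  move=> H; have [|neg] := leP 0 (Re c); first by move=> h; apply: (H c).
  apply: (H (- c)); rewrite ?nmN //.
  - by case=> r; rewrite mulrN ReN normrN => h; apply: none; exists r.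
  - by move=> r; rewrite mulrN ReN normrN.
  - by move=> j; rewrite !mulrN !ReN -opprD normrN.
  - by move=> j; rewrite mulrN ReN normrN.
  - by rewrite ReN oppr_ge0 ltW.
have ge_e j : e <= Re (b ^+ j * c).
  elim: j => [|j IH].
    by have := bigb 0%N; rewrite expr0 mul1r ger0_norm.
  have := bigb j.+1; have := step j; rewrite ltr_norml => /andP[h _].
  by rewrite ger0_norm //; lra.
(* The real parts being at least [e], their sums grow linearly, while the geometric sum formula
   bounds them uniformly. *)
pose Sg n := \sum_(j < n) b ^+ j.
have lowS n : n%:R * e <= Re (Sg n * c).
  elim: n => [|n IH]; first by rewrite /Sg big_ord0 !mul0r.
  by rewrite /Sg big_ord_recr /= mulrDl ReD -natr1 mulrDl mul1r lerD.
have upS n : Re (Sg n * c) <= 2 * nm c / nm (b - 1).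
  apply: le_trans (ler_norm _) _; apply: le_trans (nm_ge_Re _) _.
  have -> : Sg n = (b ^+ n - 1) / (b - 1).
    by apply: (mulIf b1); rewrite divfK // mulrC -subrX1.
  rewrite !nmM nmV mulrAC ler_wpM2r ?invr_ge0 ?nm_ge0 // ler_wpM2r ?nm_ge0 //.
  by apply: le_trans (nmD _ _) _; rewrite nmN nmX nb nm1 expr1n.
pose B := 2 * nm c / nm (b - 1).
have := le_trans (lowS (Num.truncn (B / e)).+1) (upS _).
by rewrite -ler_pdivlMr // leNgt truncnS_gt.
Qed.

Section Pair.
Variables (P S : R[i]) (p s : nat).
Hypothesis ok : prime_pair P p S s.

Let hP : gprime P p. Proof. by case: ok. Qed.
Let hS : gprime S s. Proof. by case: ok. Qed.
Let gP : P \in gint. Proof. exact: gprime_gint hP. Qed.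
Let gS : S \in gint. Proof. exact: gprime_gint hS. Qed.
Let gP' : P^c \in gint. Proof. exact: gprime_conj_gint hP. Qed.
Let gS' : S^c \in gint. Proof. exact: gprime_conj_gint hS. Qed.
Let nP' : P^c != 0. Proof. exact: gprime_conj_neq0 hP. Qed.
Let nS' : S^c != 0. Proof. exact: gprime_conj_neq0 hS. Qed.
Let nP : P != 0. Proof. exact: gprime_neq0 hP. Qed.
Let nS : S != 0. Proof. exact: gprime_neq0 hS. Qed.

(* With q = psk + 1, the inverses of P' and S' modulo q are -Psk and -Spk. *)
Lemma invariant_torsion k0 : exists q m t, [/\ (k0 < q)%N, (0 < m)%N, coherent P S t,
  t 0%N 0%N = q%:R^-1 &
  forall i j k l, shift P S (m * i) (m * j) t k l - t k l \in gint].
Proof.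
have [_ pp eP _] := hP; have [_ ps eS _] := hS.
pose q := (p * s * k0).+1.
have q0C : q%:R != 0 :> R[i] by rewrite pnatr_eq0.
have qE : P * P^c * (S * S^c) * k0%:R = q%:R - 1 by rewrite eP eS -!natrM -natr1 addrK.
pose v1 := - (P * (S * S^c) * k0%:R); pose v2 := - (S * (P * P^c) * k0%:R).
have gv1 : v1 \in gint by rewrite /v1; gint_tac.
have gv2 : v2 \in gint by rewrite /v2; gint_tac.
have e1 : P^c * v1 = 1 - q%:R by rewrite -opprB -qE /v1; ring.
have e2 : S^c * v2 = 1 - q%:R by rewrite -opprB -qE /v2; ring.
have c1 : copr (P * v1) q%:R.
  (* As p s k0 = q - 1, the Bezout identity is (q - 1)^2 + (2 - q) q = 1. *)
  exists (- (P^c ^+ 2 * (S * S^c) * k0%:R)); first by gint_tac.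
  exists (2 - q%:R); first by gint_tac.
  have -> : - (P^c ^+ 2 * (S * S^c) * k0%:R) * (P * v1) =
    (P * P^c * (S * S^c) * k0%:R) ^+ 2 by rewrite /v1; ring.
  by rewrite qE; ring.
have c2 : copr (S * v2) q%:R.
  exists (- (S^c ^+ 2 * (P * P^c) * k0%:R)); first by gint_tac.
  exists (2 - q%:R); first by gint_tac.
  have -> : - (S^c ^+ 2 * (P * P^c) * k0%:R) * (S * v2) =
    (P * P^c * (S * S^c) * k0%:R) ^+ 2 by rewrite /v2; ring.
  by rewrite qE; ring.
have [m1 [m10 h1]] := copr_pow_eq1 (ltn0Sn _) (gintM gP gv1) c1.
have [m2 [m20 h2]] := copr_pow_eq1 (ltn0Sn _) (gintM gS gv2) c2.
(* On this point P/P' acts as multiplication by P v1, whose m1-th power is 1 modulo q, and S/S' as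
   multiplication by S v2, whose m2-th power is 1. *)
exists q, (m1 * m2)%N, (fun k l => v1 ^+ k * v2 ^+ l / q%:R); split.
- by rewrite /q ltnS leq_pmull // muln_gt0 !prime_gt0.
- by rewrite muln_gt0 m10.
- split=> k l.
    have -> : P^c * (v1 ^+ k.+1 * v2 ^+ l / q%:R) - v1 ^+ k * v2 ^+ l / q%:R =
      (P^c * v1 - 1) * (v1 ^+ k * v2 ^+ l / q%:R) by rewrite exprS; ring.
    have -> : P^c * v1 - 1 = - q%:R by rewrite e1; ring.
    by rewrite mulNr mulrC divfK //; gint_tac.
  have -> : S^c * (v1 ^+ k * v2 ^+ l.+1 / q%:R) - v1 ^+ k * v2 ^+ l / q%:R =
    (S^c * v2 - 1) * (v1 ^+ k * v2 ^+ l / q%:R) by rewrite exprS; ring.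
  have -> : S^c * v2 - 1 = - q%:R by rewrite e2; ring.
  by rewrite mulNr mulrC divfK //; gint_tac.
- by rewrite !expr0 !mul1r.
move=> i j k l.
have [g1 gg1 d1] := gint_pow_sub1 (m2 * i) (gintX m1 (gintM gP gv1)) h1.
have [g2 gg2 d2] := gint_pow_sub1 (m1 * j) (gintX m2 (gintM gS gv2)) h2.
have -> : shift P S (m1 * m2 * i) (m1 * m2 * j) (fun k l => v1 ^+ k * v2 ^+ l / q%:R) k l -
  v1 ^+ k * v2 ^+ l / q%:R = (((P * v1) ^+ m1 ^+ (m2 * i) - 1) * (S * v2) ^+ m2 ^+ (m1 * j)
   + ((S * v2) ^+ m2 ^+ (m1 * j) - 1)) / q%:R * (v1 ^+ k * v2 ^+ l).
  rewrite /shift -!exprM !mulnA (mulnC m2 m1) !exprMn !exprD; ring.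
rewrite d1 d2.
have -> : (q%:R * g1 * (S * v2) ^+ m2 ^+ (m1 * j) + q%:R * g2) / q%:R =
   g1 * (S * v2) ^+ m2 ^+ (m1 * j) + g2 by field.
by gint_tac.
Qed.

Lemma near_integer_shift (a : R) q : (0 < q)%N ->
  exists i (n : int), (i <= q)%N /\ `|a + i%:R / q%:R - n%:~R| < q%:R^-1.
Proof.
move=> q0; have q0R : 0 < q%:R :> R by rewrite ltr0n.
have /andP[f1 f2] := floor_itv a; rewrite intrD in f2.
set f := a - (Num.floor a)%:~R.
have f0 : 0 <= f by rewrite subr_ge0.
have f1' : f < 1 by rewrite ltrBlDl.
have b0 : 0 <= (1 - f) * q%:R by rewrite mulr_ge0 // ?subr_ge0 ltW.
have /andP[t1 t2] := truncn_itv b0.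
(* The largest [i] with f + i/q <= 1 leaves a gap to 1 smaller than 1/q. *)
exists (Num.truncn ((1 - f) * q%:R)), (Num.floor a + 1); split.
  rewrite -(ler_nat R); apply: le_trans t1 _.
  by rewrite ler_piMl ?ler0n // lerBlDr lerDl.
set i := Num.truncn _ in t1 t2 *.
have -> : a + i%:R / q%:R - (Num.floor a + 1)%:~R = i%:R / q%:R - (1 - f).
  by rewrite /f intrD; ring.
have h1 : i%:R / q%:R <= 1 - f by rewrite ler_pdivrMr.
have h2 : 1 - f < (i%:R + 1) / q%:R by rewrite ltr_pdivlMr // natr1.
rewrite mulrDl mul1r in h2.
by rewrite ltr_norml; apply/andP; split; lra.
Qed.

Lemma avoid_leaf eps x : 0 < eps -> coherent P S x -> avoid eps P S x ->
  exists q, (0 < q)%N /\ leaf_mod P S q x.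
Proof.
move=> e0 sx ax; apply: contrapT => nx.
have [U [UU UN]] := ultra_nat.
have [q [m [t [qk m0 st t0 ht]]]] := invariant_torsion (Num.truncn eps^-1).
have q0 : (0 < q)%N by exact: leq_ltn_trans qk.
have qe : q%:R^-1 < eps.
  rewrite invf_plt ?posrE ?ltr0n //; apply: lt_le_trans (truncnS_gt _) _.
  by rewrite ler_nat.
(* The progression y, y + t, ..., y + r t is lengthened by induction on [r]. Its step [t] is fixed
   by m-th powers, so [E r] is invariant under them. *)
pose E r y := [/\ coherent P S y, forall q, (0 < q)%N -> ~ leaf_mod P S q y &
  forall i, (i <= r)%N -> avoid eps P S (fun k l => y k l + i%:R * t k l)].
have Enonempty r : exists y, E r y.
  elim: r => [|r [y0 hy0]].
    exists x; split=> // [q' q'0 h|i]; first by apply: nx; exists q'.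
    rewrite leqn0 => /eqP ->; apply: (avoid_congr ok) ax => k l.
    by rewrite mul0r addr0 subrr gint0.
  have Eshift y i j : E r y -> E r (shift P S (m * i) (m * j) y).
    move=> [sy ly ay]; split; first exact: (coherent_shift ok).
      by move=> q' q'0 /(leaf_shift ok q'0 sy) [q2 [q20 /ly]]; apply.
    move=> u ur; apply: (avoid_congr ok) (avoid_shift (m * i) (m * j) (ay u ur)) => k l.
    have -> : shift P S (m * i) (m * j) (fun k l => y k l + u%:R * t k l) k l -
       (shift P S (m * i) (m * j) y k l + u%:R * t k l) =
       u%:R * (shift P S (m * i) (m * j) t k l - t k l) by rewrite /shift; ring.
    by move: (ht i j k l) => ?; gint_tac.
  have Econv X y : (forall j, E r (X j)) -> conv U X y -> E r y.
    move=> hX hc; have sy : coherent P S y by apply: (conv_coherent UU ok) hc => j; case: (hX j).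
    split=> // [q' q'0 ly|i ir].
      (* Lying on no leaf passes to the limit because leaves are open among avoiding points. *)
      have [D [eta [eta0 H]]] := leaf_open ok e0 q'0 sy ly.
      have [j hj] := filter_ex (hc D D eta eta0).
      have [sX lX aX] := hX j; apply: (lX q' q'0); apply: H => //.
      apply: (avoid_congr ok) (aX 0%N (leq0n r)) => k l.
      by rewrite mul0r addr0 subrr gint0.
    apply: (conv_avoid UU ok (conv_add UU (fun k l => i%:R * t k l) hc)) => a b.
    by apply: filterS filterT => j _ n; have [_ _ aX] := hX j; exact: aX.
  have Ecoherent y : E r y -> coherent P S y by case.
  have Eleaf y q' : (0 < q')%N -> E r y -> ~ leaf_mod P S q' y by move=> q'0 [_ h _]; exact: h.
  (* With y - z = t modulo Z[i], the new term z + (r + 1) t of the progression of [z] equals y + r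
     t, which avoids the stripe. *)
  have [y [z [hy hz hyz]]] := difference_all UU UN ok m0 Ecoherent Eleaf Eshift Econv
    (ex_intro _ y0 hy0) st.
  exists z; have [sz lz az] := hz; split=> // i.
  rewrite leq_eqVlt => /orP[/eqP ->|]; last by rewrite ltnS; exact: az.
  have [_ _ ay] := hy; apply: (avoid_congr ok) (ay r (leqnn r)) => k l.
  have -> : y k l + r%:R * t k l - (z k l + r.+1%:R * t k l) = y k l - z k l - t k l.
    by rewrite -natr1; ring.
  exact: hyz.
(* For r = q the real parts at level (0, 0) advance by 1/q < eps, so one of them falls within 1/q of
   an integer. *)
have [y [sy _ ay]] := Enonempty q.
have [i [n [iq hn]]] := near_integer_shift (Re (y 0%N 0%N)) q0.
have := ay i iq 0%N 0%N n; rewrite !expr0 !mul1r t0 ReD.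
have -> : Re (i%:R / q%:R : R[i]) = i%:R / q%:R.
  by rewrite -(rmorph_nat (real_complex R) i) -(rmorph_nat (real_complex R) q) -fmorphV -rmorphM.
by move=> h; have := lt_trans (le_lt_trans h hn) qe; rewrite ltxx.
Qed.

(** Compactness: were no [q] uniform, some avoiding X j would fail for each (j+1)!. A limit lies on
    a leaf up to q-torsion, hence so do nearby X j by [leaf_open], and q divides (j+1)! once j >=
    q. *)
Lemma avoid_leaf_uniform eps : 0 < eps -> exists q, (0 < q)%N /\
  forall x, coherent P S x -> avoid eps P S x -> leaf_mod P S q x.
Proof.
move=> e0; apply: contrapT => none.
have H j : exists x, [/\ coherent P S x, avoid eps P S x & ~ leaf_mod P S j.+1`! x].
  apply: contrapT => nx; apply: none; exists j.+1`!; rewrite fact_gt0; split=> // x sx ax.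
  by apply: contrapT => lx; apply: nx; exists x.
have [X HX] := choice H.
have [U [UU UN]] := ultra_nat.
have [x hx] := conv_exists UU X.
have sx : coherent P S x by apply: (conv_coherent UU ok) hx => j; case: (HX j).
have ax : avoid eps P S x.
  apply: (conv_avoid UU ok hx) => r u; apply: filterS filterT => j _ n.
  by case: (HX j) => _ h _; exact: h.
have [q [q0 lx]] := avoid_leaf e0 sx ax.
have [D [eta [eta0 O]]] := leaf_open ok e0 q0 sx lx.
have [j [hj /= jq]] := filter_ex (filterI (hx D D eta eta0) (UN q)).
have [sX aX nX] := HX j; apply: nX.
by apply: (leaf_dvd _ (O _ sX aX hj)); rewrite dvdn_fact // q0 leqW.
Qed.

Lemma cover eps : 0 < eps -> exists q, (0 < q)%N /\
  forall z1 z2 z3 : R[i], q%:R * (z1 + z2) = z3 ->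
  exists N, (0 < N)%N /\ forall z, exists w r u (n : int),
    [/\ [\/ w = z1, w = z2 | w = z3], (r <= N)%N, (u <= N)%N &
      `|Re (w * ((P / P^c) ^+ r * (S / S^c) ^+ u) * z) - n%:~R| < eps].
Proof.
move=> e0; have [q [q0 Hq]] := avoid_leaf_uniform e0.
exists q; split=> // z1 z2 z3 hz; apply: contrapT => none.
have H N : exists z, forall w r u (n : int), [\/ w = z1, w = z2 | w = z3] ->
    (r <= N.+1)%N -> (u <= N.+1)%N ->
    eps <= `|Re (w * ((P / P^c) ^+ r * (S / S^c) ^+ u) * z) - n%:~R|.
  apply: contrapT => nz; apply: none; exists N.+1; split=> // z.
  apply: contrapT => nw; apply: nz; exists z => w r u n hw hr hu.
  by rewrite leNgt; apply/negP => h; apply: nw; exists w, r, u, n.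
have [Z HZ] := choice H.
have [U [UU UN]] := ultra_nat.
pose X w j := emb P S (w * Z j).
have sX w j : coherent P S (X w j) by exact: (emb_coherent ok).
have K w : [\/ w = z1, w = z2 | w = z3] ->
  exists x c, [/\ conv U (X w) x, avoid eps P S x &
    forall k l, q%:R * (x k l - emb P S c k l) \in gint].
  move=> hw; have [x hx] := conv_exists UU (X w).
  have ax : avoid eps P S x.
    apply: (conv_avoid UU ok hx) => r u; apply: filterS (UN (maxn r u)) => j /=.
    rewrite geq_max => /andP[rj uj] n.
    have := HZ j w r u n hw (leqW rj) (leqW uj).
    congr (_ <= `|Re _ - _|); rewrite /X /emb !exprMn !exprVn; field.
    by rewrite !expf_neq0.
  have [c hc] := Hq x (conv_coherent UU ok (sX w) hx) ax.
  by exists x, c.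
have [x1 [c1 [h1 _ t1]]] := K z1 ltac:(by constructor 1).
have [x2 [c2 [h2 _ t2]]] := K z2 ltac:(by constructor 2).
have [x3 [c3 [h3 a3 _]]] := K z3 ltac:(by constructor 3).
have rel k l : q%:R * (x1 k l + x2 k l) - x3 k l \in gint.
  apply: gint_closed => e ee0.
  have qR : 0 < q%:R :> R by rewrite ltr0n.
  have d0 : 0 < e / 3 / q%:R by rewrite !divr_gt0.
  have d3 : 0 < e / 3 by rewrite divr_gt0.
  have [j [[[g1 gg1 k1] [g2 gg2 k2]] [g3 gg3 k3]]] :=
    filter_ex (filterI (filterI (h1 k l _ d0) (h2 k l _ d0)) (h3 k l _ d3)).
  have eX : X z3 j k l = q%:R * (X z1 j k l + X z2 j k l) by rewrite /X /emb -hz; ring.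
  exists (g3 - q%:R * (g1 + g2)); first by gint_tac.
  have -> : q%:R * (x1 k l + x2 k l) - x3 k l - (g3 - q%:R * (g1 + g2)) =
    - (q%:R * (X z1 j k l - x1 k l - g1)) - q%:R * (X z2 j k l - x2 k l - g2)
     + (X z3 j k l - x3 k l - g3) by rewrite eX; ring.
  apply: le_lt_trans (nmD _ _) _.
  have -> : e = e / 3 + e / 3 + e / 3 by field.
  apply: ltrD => //; apply: le_lt_trans (nmD _ _) _.
  by rewrite !nmN !nmM nm_nat; apply: ltrD; rewrite mulrC -ltr_pdivlMr.
(* [x1] and [x2] lie on the leaf up to q-torsion, which the factor [q] kills; so x3 = q (x1 + x2) is
   the image of [c]. *)
pose c := q%:R * (c1 + c2).
have x3c k l : x3 k l - emb P S c k l \in gint.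
  have -> : x3 k l - emb P S c k l = - (q%:R * (x1 k l + x2 k l) - x3 k l) +
     q%:R * (x1 k l - emb P S c1 k l) + q%:R * (x2 k l - emb P S c2 k l).
    by rewrite /c /emb; ring.
  by move: (rel k l) (t1 k l) (t2 k l) => ? ? ?; gint_tac.
have a3c : avoid eps P S (emb P S c) by exact: (avoid_congr ok x3c).
have [|M M0|r hr] := @rotation_small_Re (P / P^c) c eps _ _ e0.
- by rewrite nmM nmV nm_conjc divff // nm_eq0.
- rewrite expr_div_n; apply/eqP => h.
  have [_ _ _ cP] := hP.
  have nP1 : nm P^c != 1 by rewrite gt_eqF // (gprime_nm_gt1 hP).
  have := copr_pow_neq cP nP1 gP gP' (esym (nm_conjc P)) M0.
  by rewrite -(divfK (expf_neq0 M nP') (P ^+ M)) h mul1r eqxx.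
have := a3c r 0%N 0; rewrite subr0 leNgt => /negP; apply.
have -> // : P ^+ r * S ^+ 0 * emb P S c r 0 = (P / P^c) ^+ r * c.
by rewrite /emb !expr0 !mulr1 expr_div_n; ring.
Qed.

End Pair.
End Covering.

(** * The primes over 5 and 13, and the conclusion *)

Lemma prime_pair_5_13 (R : realType) :
  prime_pair (1 +i* 2 : R[i]) 5 (2 +i* 3 : R[i]) 13.
Proof.
set P : R[i] := 1 +i* 2; set S : R[i] := 2 +i* 3.
have gP : P \in @gint R by exact: (gint_mk R 1 2).
have gS : S \in @gint R by exact: (gint_mk R 2 3).
have gP' := gint_conj gP; have gS' := gint_conj gS.
have eqC (x : R[i]) n : Re x = n%:R -> Im x = 0 -> x = n%:R.
  by move=> h1 h2; apply/eqP; rewrite eq_complex h1 h2 Re_nat Im_nat !eqxx.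
have eP : P * P^c = 5%:R by apply: eqC; rewrite ?(ReM, ImM, ReD, ImD) /P /S /=; ring.
have eS : S * S^c = 13%:R by apply: eqC; rewrite ?(ReM, ImM, ReD, ImD) /P /S /=; ring.
have tP : P + P^c = 2%:R by apply: eqC; rewrite ?(ReM, ImM, ReD, ImD) /P /S /=; ring.
have tS : S + S^c = 4%:R by apply: eqC; rewrite ?(ReM, ImM, ReD, ImD) /P /S /=; ring.
(* The identity 2 * 13 - 5 * 5 = 1 yields the Bezout relations of all the pairs that mix the two
   primes. *)
have key : 2 * (S * S^c) - 5 * (P * P^c) = 1 by rewrite eP eS; ring.
split.
- split=> //; exists (P^c - 2); first by gint_tac.
  exists (- 2); first by gint_tac.
  have -> : (P^c - 2) * P + - 2 * P^c = P * P^c - 2 * (P + P^c) by ring.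
  by rewrite eP tP; ring.
- split=> //; exists (S^c - 3); first by gint_tac.
  exists (- 3); first by gint_tac.
  have -> : (S^c - 3) * S + - 3 * S^c = S * S^c - 3 * (S + S^c) by ring.
  by rewrite eS tS; ring.
- exists (- (5 * P)); first by gint_tac.
  by exists (2 * S); [gint_tac | rewrite -[RHS]key; ring].
- exists (2 * S^c); first by gint_tac.
  by exists (- (5 * P)); [gint_tac | rewrite -[RHS]key; ring].
- exists (- (5 * P^c)); first by gint_tac.
  by exists (2 * S); [gint_tac | rewrite -[RHS]key; ring].
Qed.

Theorem theorem2p1 (R : realType) (eps : R) (heps : 0 < eps)
    (zeta1 zeta2 zeta3 : nat -> R[i])
    (hunit : forall n : nat, (1 <= n)%N ->
       [/\ `|zeta1 n| = 1, `|zeta2 n| = 1 & `|zeta3 n| = 1])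
    (hzeta : forall n : nat, (1 <= n)%N ->
       n%:R * (zeta1 n + zeta2 n) = zeta3 n) :
  exists n N : nat, [/\ (1 <= n)%N, (1 <= N)%N &
    \bigcup_(theta in Theta' zeta1 zeta2 zeta3 n N) rot_stripe eps theta
      = [set: R[i]]].
Proof.
have [n [n0 Hn]] := cover (prime_pair_5_13 R) heps.
have [N [N0 HN]] := Hn _ _ _ (hzeta n n0).
exists n, N; split=> //; rewrite -subTset => z _.
have [w [r [u [k [hw hr hu hk]]]]] := HN z.
exists (w * (theta5 ^+ r * theta13 ^+ u)); last by exists k.
by case: hw => ->; [left; left | left; right | right];
  exists (theta5 ^+ r * theta13 ^+ u) => //; exists r => //; exists u.
Qed.
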